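(* Let $K$ be an algebraically closed field, let $\Omega$ be a signature, let $G$ be any semigroup, and let $A$ and $B$ be two finite-dimensional $G$-graded $\Omega$-algebras over $K$ which are simple as $G$-graded $\Omega$-algebras. Then $A$ is isomorphic to $B$ as a $G$-graded $\Omega$-algebra if and only if $A$ and $B$ satisfy the same $G$-graded polynomial identities as $G$-graded $\Omega$-algebras.
   Context: A signature is a set $\Omega=\bigcup_{m\ge 0}\Omega_m$ (disjoint union); it is assumed throughout that $\bigcup_{m\ge 2}\Omega_m\neq\emptyset$. An $\Omega$-algebra over $K$ is a $K$-vector space $A$ such that every $\omega\in\Omega_m$ defines an $m$-linear operation $\omega:A\otimes\cdots\otimes A\to A$ ($m$ factors); for $m=0$ this is a distinguished element of $A$. Homomorphisms are linear maps commuting with all operations. An ideal is a subspace $I$ with $\omega(a_1,\ldots,a_m)\in I$ whenever $m\ge1$, $\omega\in\Omega_m$ and some $a_i\in I$. A $G$-graded $\Omega$-algebra is an $\Omega$-algebra $A$ with a vector space decomposition $A=\bigoplus_{g\in G}A_g$ such that every operation is $G$-homogeneous: for $m\ge 1$, $\omega\in\Omega_m$, one has $\omega(A_{g_1},\ldots,A_{g_m})\subset A_{g_1\cdots g_m}$ for all $g_1,\ldots,g_m\in G$; for $0$-ary operations, a degree $\deg_G\omega\in G$ is fixed once and for all for each $\omega\in\Omega_0$, and the element of $A$ given by $\omega$ is required to lie in $A_{\deg_G\omega}$. Homomorphisms of $G$-graded $\Omega$-algebras are homomorphisms of $\Omega$-algebras $\varphi:A\to B$ with $\varphi(A_g)\subset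 B_g$ for all $g$; isomorphisms are the bijective ones. A graded ideal is an ideal $I$ with $I=\bigoplus_g (I\cap A_g)$. $A$ is simple as a $G$-graded $\Omega$-algebra if some operation $\omega\in\Omega_m$ with $m\ge2$ is nonzero on $A$ and the only graded ideals of $A$ are $0$ and $A$. Let $X$ be a countably infinite set and $X^G=\{x^{(g)}\mid x\in X,\ g\in G\}$. Let $F_\Omega(X^G)$ be the free $\Omega$-algebra on $X^G$ (the vector space with basis all $\Omega$-monomials in $X^G$). An element $f\in F_\Omega(X^G)$ is a $G$-graded polynomial identity of $A$ if it is mapped to $0$ by every $\Omega$-algebra homomorphism $F_\Omega(X^G)\to A$ sending each $x^{(g)}$ into $A_g$. *)

(* Defs.v *)
From HB Require Import structures.
From mathcomp Require Import all_boot all_order all_algebra.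
From mathcomp Require Import finmap.
From Stdlib Require Eqdep_dec.
From mathcomp Require Import boolp.
From mathcomp.multinomials Require Import monalg.

Set Implicit Arguments.
Unset Strict Implicit.
Unset Printing Implicit Defensive.

Import GRing.Theory.
Local Open Scope ring_scope.

(* A signature is a family [Omega : nat -> Type]; [Omega m] is the set of
   m-ary operation symbols. *)

Definition upd (m : nat) (T : Type) (a : {ffun 'I_m -> T}) (i : 'I_m) (x : T) :
    {ffun 'I_m -> T} :=
  [ffun j => if j == i then x else a j].

HB.mixin Record Lmodule_isOmegaAlgebra (Omega : nat -> Type) (K : fieldType) A
    of GRing.Lmodule K A := {
  oapp : forall m, Omega m -> {ffun 'I_m -> A} -> A;
  oapp_multilinear : forall m (w : Omega m) (i : 'I_m) (a : {ffun 'I_m -> A})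
      (c : K) (x y : A),
    oapp m w (upd a i (c *: x + y))
      = c *: oapp m w (upd a i x) + oapp m w (upd a i y)
}.

#[short(type="omegaAlgType")]
HB.structure Definition OmegaAlgebra (Omega : nat -> Type) (K : fieldType) :=
  { A of GRing.Lmodule K A & Lmodule_isOmegaAlgebra Omega K A }.

Arguments oapp {Omega K s m} w a : rename.

(* The product g_0 g_1 ... g_m in a semigroup, which need not have a unit. *)
Definition sgprod (G : semigroupType) (m : nat) (g : 'I_m.+1 -> G) : G :=
  foldl (fun x y => (x * y)%g) (g ord0) [seq g (lift ord0 i) | i <- enum 'I_m].

(* [U] is the internal direct sum of the family [V], whose index set may be
   infinite: every element of [U] lies in a finite partial sum, every finite
   partial sum lies in [U], and every finite partial sum is direct. *)
Definition is_direct_sum (K : fieldType) (A : vectType K) (I : eqType)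
    (U : {vspace A}) (V : I -> {vspace A}) : Prop :=
  (forall a : A,
     a \in U <-> exists s : seq I, uniq s /\ a \in (\sum_(i <- s) V i)%VS) /\
  (forall s : seq I, uniq s -> directv (\sum_(i <- s) V i)).

(* [deg0] assigns their degrees to the 0-ary operations. *)
HB.mixin Record isGraded (Omega : nat -> Type) (K : fieldType)
    (G : semigroupType) (deg0 : Omega 0%N -> G) A
    of Vector K A & OmegaAlgebra Omega K A := {
  grcomp : G -> {vspace A};
  gr_direct_sum : is_direct_sum fullv grcomp;
  gr_homogeneous : forall m (w : Omega m.+1) (g : 'I_m.+1 -> G)
      (a : {ffun 'I_m.+1 -> A}),
    (forall i, a i \in grcomp (g i)) -> oapp w a \in grcomp (sgprod g);
  gr_nullary : forall (w : Omega 0%N) (a : {ffun 'I_0 -> A}),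
    oapp w a \in grcomp (deg0 w)
}.

(* Finite-dimensional G-graded Omega-algebras over K. *)
#[short(type="grOmegaAlgType")]
HB.structure Definition GrOmegaAlgebra (Omega : nat -> Type) (K : fieldType)
    (G : semigroupType) (deg0 : Omega 0%N -> G) :=
  { A of Vector K A & OmegaAlgebra Omega K A & isGraded Omega K G deg0 A }.

Arguments grcomp {Omega K G deg0} s g : rename.

Definition omega_morphism (Omega : nat -> Type) (K : fieldType)
    (A B : omegaAlgType Omega K) (phi : {linear A -> B}) : Prop :=
  forall m (w : Omega m) (a : {ffun 'I_m -> A}),
    phi (oapp w a) = oapp w [ffun i => phi (a i)].

Section Graded.
Variables (Omega : nat -> Type) (K : fieldType) (G : semigroupType).
Variable (deg0 : Omega 0%N -> G).
Implicit Types A B : grOmegaAlgType K deg0.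

Definition gr_isomorphic A B : Prop :=
  exists phi : {linear A -> B},
    [/\ omega_morphism phi,
        forall (g : G) (a : A), a \in grcomp A g -> phi a \in grcomp B g
      & bijective phi].

Definition omega_ideal A (I : {vspace A}) : Prop :=
  forall m (w : Omega m) (a : {ffun 'I_m -> A}) (i : 'I_m),
    a i \in I -> oapp w a \in I.

Definition graded_ideal A (I : {vspace A}) : Prop :=
  omega_ideal I /\ is_direct_sum I (fun g => (I :&: grcomp A g)%VS).

Definition gr_simple A : Prop :=
  (exists m (w : Omega m) (a : {ffun 'I_m -> A}), (2 <= m)%N /\ oapp w a <> 0) /\
  (forall I : {vspace A}, graded_ideal I -> I = 0%VS \/ I = fullv).

End Graded.

Section Free.
Variables (Omega : nat -> Type) (K : fieldType) (V : Type).

Inductive omonom : Type :=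
| OVar of V
| OApp (m : nat) (w : Omega m) of {ffun 'I_m -> omonom}.

HB.instance Definition _ := gen_eqMixin omonom.
HB.instance Definition _ := gen_choiceMixin omonom.

Definition free_omega : Type := {malg K[omonom]}.

HB.instance Definition _ := GRing.Lmodule.on free_omega.

Definition ofree_var (v : V) : free_omega := << OVar v >>.

(* Multilinear extension of [OApp w] from monomials to their span: expand each
   argument over the union of the supports. *)
Definition ofree_app (m : nat) (w : Omega m) (f : {ffun 'I_m -> free_omega}) :
    free_omega :=
  let D : {fset omonom} := (\bigcup_(i <- enum 'I_m) msupp (f i))%fset in
  \sum_(u : {ffun 'I_m -> D})
    << \prod_(i : 'I_m) (f i)@_(val (u i)) *g OApp w [ffun i => val (u i)] >>.

Lemma OApp_inj (m : nat) (w : Omega m) : injective (OApp w).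
Proof.
move=> t t' [] e.
exact: (Eqdep_dec.inj_pair2_eq_dec _ (@eq_comparable _) _ _ _ _ e).
Qed.

Lemma ofree_appE (m : nat) (w : Omega m) (f : {ffun 'I_m -> free_omega}) t :
  (ofree_app w f)@_(OApp w t) = \prod_(i : 'I_m) (f i)@_(t i).
Proof.
rewrite /ofree_app raddf_sum /=.
set D := (\bigcup_(i <- enum 'I_m) msupp (f i))%fset.
have supD i k : k \in msupp (f i) -> k \in D.
  by move=> h; apply/bigfcupP; exists i; rewrite ?mem_enum.
case: (pselect (forall i, t i \in D)) => [tD|].
  pose u : {ffun 'I_m -> D} := [ffun i => FSetSub (tD i)].
  have uE : [ffun i => val (u i)] = t by apply/ffunP => i; rewrite !ffunE.
  rewrite (bigD1 u) //= uE mcoeffUU [X in _ + X]big1 => [|u' ne].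
    by rewrite addr0; apply: eq_bigr => i _; rewrite ffunE.
  rewrite mcoeffU; case: eqP => // /OApp_inj e; case/eqP: ne.
  by apply/ffunP => i; apply: val_inj; rewrite ffunE /= -e ffunE.
case/existsNP => i /negP tiD; rewrite big1 => [|u _].
  rewrite (bigD1 i) //= mcoeff_outdom ?mul0r //.
  by apply: contra tiD; apply: supD.
rewrite mcoeffU; case: eqP => // /OApp_inj e.
by case/negP: tiD; rewrite -e ffunE; apply: valP.
Qed.

Lemma ofree_app_out (m : nat) (w : Omega m) (f : {ffun 'I_m -> free_omega}) k :
  (forall t, k <> OApp w t) -> (ofree_app w f)@_k = 0.
Proof.
move=> kN; rewrite /ofree_app raddf_sum /= big1 // => u _.
by rewrite mcoeffU; case: eqP => // /esym /kN.
Qed.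

Lemma ofree_app_multilinear (m : nat) (w : Omega m) (i : 'I_m)
    (a : {ffun 'I_m -> free_omega}) (c : K) (x y : free_omega) :
  ofree_app w (upd a i (c *: x + y))
    = c *: ofree_app w (upd a i x) + ofree_app w (upd a i y).
Proof.
apply/malgP => k; rewrite mcoeffD mcoeffZ.
case: (pselect (exists t, k = OApp w t)) => [[t ->]|kN]; last first.
  by rewrite !ofree_app_out ?mulr0 ?addr0 // => t e; apply: kN; exists t.
rewrite !ofree_appE !(bigD1 (P := xpredT) i) //= !ffunE eqxx.
have E z : \prod_(j < m | j != i) ((upd a i z) j)@_(t j)
         = \prod_(j < m | j != i) (a j)@_(t j).
  by apply: eq_bigr => j /negbTE ji; rewrite ffunE ji.
by rewrite !E mcoeffD mcoeffZ mulrDl mulrA.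
Qed.

HB.instance Definition _ :=
  Lmodule_isOmegaAlgebra.Build Omega K free_omega ofree_app_multilinear.

Lemma ofree_app_monom (m : nat) (w : Omega m) (t : {ffun 'I_m -> omonom}) :
  oapp w [ffun i => << t i >> : free_omega] = << OApp w t >> :> free_omega.
Proof.
apply/malgP => k; rewrite mcoeffU /oapp /=.
case: (pselect (exists t', k = OApp w t')) => [[t' ->]|kN]; last first.
  rewrite ofree_app_out => [|t' e]; last by apply: kN; exists t'.
  by case: eqP => // e; case: kN; exists t.
rewrite ofree_appE; case: eqP => [/OApp_inj <-|ne].
  by rewrite big1 // => i _; rewrite ffunE mcoeffUU.
have /existsNP[i /eqP ti] : ~ (forall i, t i = t' i).
  by move=> e; apply: ne; congr OApp; apply/ffunP.
by rewrite (bigD1 i) //= ffunE mcoeffU (negbTE ti) mul0r.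
Qed.

End Free.

(* The free Omega-algebra is taken on X^G = X * G, with (x, g) standing for
   the variable x^(g). *)
Definition gr_identity (Omega : nat -> Type) (K : fieldType)
    (G : semigroupType) (deg0 : Omega 0%N -> G) (X : Type)
    (A : grOmegaAlgType K deg0) (f : free_omega Omega K (X * G)) : Prop :=
  forall phi : {linear free_omega Omega K (X * G) -> A},
    omega_morphism phi ->
    (forall (x : X) (g : G), phi (ofree_var Omega K (x, g)) \in grcomp A g) ->
    phi f = 0.

(* Main.v *)
From HB Require Import structures.
Require Import Defs.
From mathcomp Require Import all_boot all_order all_algebra.
From mathcomp Require Import all_fingroup.
From mathcomp Require Import finmap boolp.
From mathcomp.multinomials Require Import mpoly.
From mathcomp.multinomials Require monalg.
Import Defs.

(** An isomorphism carries the graded homomorphisms from the free algebra to A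
    to those from the free algebra to B, so it preserves identities.

    For the converse, treat the projections onto the homogeneous components as
    further unary operations.  Graded ideals become plain ideals, and terms
    built with these projections are still values of graded polynomials
    ([term_polyE]), so A and B satisfy the same term identities.  It suffices
    to find generating tuples a of A and b of B at which the same terms
    vanish: sending the value of a term at a to its value at b is then an
    isomorphism ([isomorphic_of_kernel]).

    What decides whether a term vanishes are the determinants of the linear
    operators x |-> c(x), where c is a term with a hole, evaluated at a tuple.
    By simplicity these operators act irreducibly ([ctx_irreducible]); hence if
    t vanishes at a but not at b, one can build from t an operator 1 + W C that
    is the identity at a and singular at b ([kernel_transfer]).  So the goal
    becomes det c(a) = det c(b) for all c.

    These determinants obey the same polynomial relations on A and on B.
    Indeed Burnside's theorem yields a term that alternates in n = dim A
    arguments and does not vanish on A ([exists_alternating_term]).  It vanishes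
    on algebras of dimension less than n, so A and B have equal dimensions; and
    in dimension n, putting c(x_i) for each argument x_i multiplies it by det c.
    Therefore the product of this term with any polynomial in determinants is
    again given by a term, and whether it is an identity is the same question
    for A and for B ([dval_eq0_term]).

    So the ring R of polynomials in these determinants embeds both in the
    polynomial functions on A^n and in those on B^n.  As K is algebraically
    closed, a homomorphism R -> K that does not kill a suitable nonzero r is
    evaluation at a point of B^n with linearly independent entries
    ([extension_point]).  Applying this to evaluation at a general point a of
    A^n produces b. *)

Set Implicit Arguments.
Unset Strict Implicit.
Unset Printing Implicit Defensive.
Import GRing.Theory.
Local Open Scope ring_scope.

(** * Extension of points along finitely generated ring extensions *)

Section Extension.
Variables (K : closedFieldType) (S : idomainType).

(** Polynomials over R are divided as if they lay over the domain [beta R]: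
    degrees are measured after [beta], since coefficients killed by [beta]
    cannot be removed over R. *)
Lemma pseudo_division_along (R : comNzRingType) (beta : {rmorphism R -> S})
    (g q : {poly R}) :
  map_poly beta g != 0 ->
  exists (k : nat) (u : {poly R}),
    (size (map_poly beta (g`_(size (map_poly beta g)).-1 ^+ k *: q - u * g)%R)
      < size (map_poly beta g))%N.
Proof.
move=> g0; set d := size (map_poly beta g); set c := g`_d.-1.
have d_gt0 : (0 < d)%N by rewrite size_poly_gt0.
move: {2}(size (map_poly beta q)) (leqnn (size (map_poly beta q))) => N.
elim: N q => [|N IH] q.
  move=> q0; exists 0%N, 0; rewrite mul0r subr0 expr0 scale1r.
  exact: leq_ltn_trans q0 d_gt0.
move=> szq; case: (ltnP (size (map_poly beta q)) d) => [lt|ge].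
  by exists 0%N, 0; rewrite mul0r subr0 expr0 scale1r.
set e := size (map_poly beta q) in szq ge.
pose h : {poly R} := q`_e.-1 *: 'X^(e - d).
have bc : beta c = lead_coef (map_poly beta g) by rewrite lead_coefE coef_map.
have bq : beta q`_e.-1 = lead_coef (map_poly beta q).
  by rewrite lead_coefE coef_map.
have e_gt0 : (0 < e)%N by apply: leq_trans ge.
have [|k [u Hu]] := IH (c *: q - h * g).
  rewrite rmorphB rmorphM /= !map_polyZ map_polyXn /= bc bq.
  set G := map_poly beta g; set Q := map_poly beta q.
  rewrite -ltnS; apply: leq_trans szq; rewrite -[X in (_ < X)%N](prednK e_gt0).
  apply/leq_sizeP => j; rewrite leq_eqVlt coefB -scalerAl !coefZ coefXnM.
  case/predU1P=> [<-|lt].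
    have -> : (e.-1 < e - d)%N = false.
      by apply/negbTE; rewrite -leqNgt -subn1 leq_sub2l.
    have -> : (e.-1 - (e - d))%N = d.-1.
      by rewrite -!subn1 subnAC subKn.
    by rewrite -!lead_coefE mulrC subrr.
  have eq : (e <= j)%N by rewrite -(prednK e_gt0).
  rewrite [Q`_j]nth_default // mulr0 sub0r.
  case: ifP => _; rewrite ?mulr0 ?oppr0 //.
  rewrite nth_default ?mulr0 ?oppr0 //.
  by rewrite leq_subRL ?subnK // (leq_trans _ eq) // leq_subr.
exists k.+1, (c ^+ k *: h + u).
rewrite (_ : _ - _ = c ^+ k *: (c *: q - h * g) - u * g) //.
by rewrite exprSr -scalerA scalerBr mulrDl opprD addrA scalerAl.
Qed.


Lemma min_size_witness (R : comNzRingType) (beta : {rmorphism R -> S})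
    (P : {poly R} -> Prop) (q : {poly R}) :
  P q -> exists2 g, P g & forall h, P h ->
    (size (map_poly beta g) <= size (map_poly beta h))%N.
Proof.
move=> Pq; pose Q n := `[< exists2 g, P g & size (map_poly beta g) = n >].
have exQ : exists n, Q n by exists (size (map_poly beta q)); apply/asboolP; exists q.
case: (ex_minnP exQ) => n /asboolP[g Pg <-] min; exists g => // h Ph.
by apply: min; apply/asboolP; exists h.
Qed.

(** A homomorphism defined on R extends to R[x] as soon as it is nonzero at one
    suitable r.  If x is transcendental over [beta R], any xi which is not a
    root of the image of s works, and r only has to keep that image nonzero.
    If x is algebraic, let q0 be an annihilator of least degree: xi must be a
    root of the image of q0, which exists when the leading coefficient c of q0
    survives, and s(xi) divides the image of some nonzero e of R that is a
    multiple of s(x) in R[x]. *)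
Lemma extend_to_one_generator (R : comNzRingType) (beta : {rmorphism R -> S})
    (x : S) (s : {poly R}) :
  (map_poly beta s).[x] != 0 ->
  exists r : R, beta r != 0 /\ forall phi : {rmorphism R -> K},
    (forall r', beta r' = 0 -> phi r' = 0) -> phi r != 0 ->
    exists xi : K,
      (forall q : {poly R}, (map_poly beta q).[x] = 0 ->
         (map_poly phi q).[xi] = 0) /\ (map_poly phi s).[xi] != 0.
Proof.
move=> s0.
have kerpoly (phi : {rmorphism R -> K}) (q : {poly R}) :
    (forall r', beta r' = 0 -> phi r' = 0) ->
    map_poly beta q = 0 -> map_poly phi q = 0.
  move=> ker q0; apply/polyP => i; rewrite coef_map coef0 /=; apply: ker.
  by rewrite -coef_map q0 coef0.
have coef_out (q : {poly R}) j : (size (map_poly beta q) <= j)%N -> beta q`_j = 0.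
  by move=> le; rewrite -coef_map nth_default.
case: (pselect (exists q, (map_poly beta q).[x] = 0 /\ map_poly beta q <> 0));
    last first.
  move=> transc.
  have sb0 : map_poly beta s != 0 by apply: contraNneq s0 => ->; rewrite horner0.
  exists s`_(size (map_poly beta s)).-1; split.
    by rewrite -coef_map -lead_coefE lead_coef_eq0.
  move=> phi ker phis; have /closed_nonrootP[xi nr] : map_poly phi s != 0.
    apply: contraNneq phis => e0; rewrite -coef_map e0 coef0 //.
  exists xi; split=> // q q0; rewrite (kerpoly phi q) ?horner0 //.
  by apply: contra_notP transc => ne; exists q.
case=> q1 /(@min_size_witness R beta
  (fun q => (map_poly beta q).[x] = 0 /\ map_poly beta q <> 0)).
case=> q0 [q0x /eqP q00] q0min {q1}.
have small q : (map_poly beta q).[x] = 0 ->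
    (size (map_poly beta q) < size (map_poly beta q0))%N -> map_poly beta q = 0.
  move=> qx lt; apply: contrapT => ne.
  by move: (q0min q (conj qx ne)); rewrite leqNgt lt.
pose c := q0`_(size (map_poly beta q0)).-1.
have bc : beta c != 0 by rewrite -coef_map -lead_coefE lead_coef_eq0.
(* e is found as a multiple of s(x) of least degree as a polynomial in x *)
have [e [v [be ve]]] : exists e v, beta e != 0 /\
    (map_poly beta (v * s - e%:P)).[x] = 0.
  have s1 : exists v, (map_poly beta (v * s - s)).[x] = 0.
    by exists 1; rewrite mul1r subrr rmorph0 horner0.
  have [g [gx [v gv]] gmin] := @min_size_witness R beta (fun q =>
    (map_poly beta q).[x] != 0 /\ exists v, (map_poly beta (v * s - q)).[x] = 0) s
    (conj s0 s1).
  have g0 : map_poly beta g != 0 by apply: contraNneq gx => ->; rewrite horner0.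
  pose d := g`_(size (map_poly beta g)).-1.
  have bd : beta d != 0 by rewrite -coef_map -lead_coefE lead_coef_eq0.
  have gv' : (map_poly beta v).[x] * (map_poly beta s).[x] = (map_poly beta g).[x].
    by apply/eqP; rewrite -hornerM -subr_eq0 -hornerN -hornerD -rmorphM -rmorphB gv.
  (* otherwise the remainder of g by q0 would be a shorter multiple of s(x) *)
  have lt_g : (size (map_poly beta g) < size (map_poly beta q0))%N.
    rewrite ltnNge; apply/negP => le.
    have [k [u lt]] := pseudo_division_along g q00.
    have := leq_trans lt le; rewrite ltnNge => /negP; apply; apply: gmin.
    have E : (map_poly beta (c ^+ k *: g - u * q0)).[x]
             = beta c ^+ k * (map_poly beta g).[x].
      rewrite rmorphB rmorphM /= map_polyZ hornerD hornerN hornerM hornerZ.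
      by rewrite q0x mulr0 subr0 rmorphXn.
    split; first by rewrite E mulf_neq0 // expf_neq0.
    exists (c ^+ k *: v); rewrite rmorphB hornerD hornerN E rmorphM hornerM /=.
    by rewrite map_polyZ hornerZ -mulrA gv' rmorphXn subrr.
  (* the remainder of q0 by g is a multiple of s(x), hence zero; so g divides
     q0 and, q0 being least, g is a constant *)
  have [k [u lt]] := pseudo_division_along q0 g0.
  have ux : (map_poly beta (d ^+ k *: q0 - u * g)).[x]
      = - ((map_poly beta u).[x] * (map_poly beta g).[x]).
    rewrite rmorphB rmorphM /= map_polyZ hornerD hornerN hornerM hornerZ.
    by rewrite q0x mulr0 sub0r.
  have rem0 : (map_poly beta (d ^+ k *: q0 - u * g)).[x] = 0.
    apply/eqP/negPn/negP => ne; move: lt; rewrite ltnNge => /negP; apply.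
    apply: gmin; split=> //; exists (- (u * v)).
    rewrite rmorphB hornerD hornerN ux rmorphM rmorphN rmorphM /= opprK.
    by rewrite hornerM hornerN hornerM mulNr -mulrA gv' addNr.
  have ux0 : (map_poly beta u).[x] = 0.
    by apply/eqP; move/eqP: rem0; rewrite ux oppr_eq0 mulf_eq0 (negbTE gx) orbF.
  have := small _ rem0 (ltn_trans lt lt_g).
  rewrite rmorphB rmorphM /= map_polyZ => /eqP; rewrite subr_eq0 => /eqP Eq.
  have dk : beta (d ^+ k) != 0 by rewrite rmorphXn expf_neq0.
  have u0 : map_poly beta u != 0.
    by apply: contraNneq q00 => u0; move/eqP: Eq; rewrite u0 mul0r scale_poly_eq0 (negbTE dk).
  have := congr1 (fun p : {poly S} => size p) Eq.
  rewrite /= size_scale // size_mul // => sz.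
  have szg : (size (map_poly beta g) <= 1)%N.
    rewrite leqNgt; apply/negP => gt1.
    have le : (size (map_poly beta q0) <= size (map_poly beta u))%N.
      by apply: q0min; split=> //; apply/eqP.
    move: le; rewrite sz leqNgt => /negP; apply.
    by rewrite -(prednK (ltnW gt1)) addnS /= -[X in (X < _)%N]addn0 ltn_add2l -subn1 subn_gt0.
  exists g`_0, v; split.
    rewrite -coef_map; apply: contraNneq gx => e0.
    by rewrite (size1_polyC szg) e0 hornerC.
  rewrite rmorphB hornerD hornerN rmorphM hornerM gv' /= map_polyC hornerC.
  by rewrite (size1_polyC szg) hornerC -coef_map subrr.
exists (c * e); split; first by rewrite rmorphM mulf_neq0.
move=> phi ker; rewrite rmorphM mulf_eq0 negb_or => /andP[pc pe].
have szq0 : (1 < size (map_poly beta q0))%N.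
  rewrite ltn_neqAle eq_sym size_poly_gt0 q00 andbT; apply: contraTneq bc => sz1.
  have := q0x; rewrite (size1_polyC (eq_leq sz1)) hornerC coef_map /c sz1 /= => ->.
  by rewrite eqxx.
have /closed_rootP[xi /rootP q0xi] : size (map_poly phi q0) != 1%N.
  apply: contraNneq pc => sz1; rewrite -coef_map nth_default //.
  by rewrite sz1 -subn1 subn_gt0.
have kerxi (q : {poly R}) : (map_poly beta q).[x] = 0 -> (map_poly phi q).[xi] = 0.
  move=> qx; have [k [u lt]] := pseudo_division_along q q00.
  have := small _ _ lt; rewrite rmorphB rmorphM /= map_polyZ hornerD hornerN.
  rewrite hornerM hornerZ qx q0x !mulr0 subr0 => /(_ erefl).
  rewrite -[X in _ - X]rmorphM -map_polyZ -rmorphB => /(kerpoly phi _ ker).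
  rewrite rmorphB rmorphM /= map_polyZ => /(congr1 (horner^~ xi)).
  rewrite hornerD hornerN hornerM hornerZ q0xi mulr0 subr0 horner0 => /eqP.
  by rewrite mulf_eq0 rmorphXn expf_eq0 (negbTE pc) andbF => /eqP.
exists xi; split=> //; apply: contraNneq pe => sxi.
have := kerxi _ ve; rewrite rmorphB rmorphM /= map_polyC hornerD hornerN hornerM.
by rewrite sxi mulr0 hornerC sub0r => /eqP; rewrite oppr_eq0.
Qed.

Inductive generated (R : nzRingType) (beta : R -> S) (xs : seq S) : S -> Prop :=
| gen_base r : generated beta xs (beta r)
| gen_var x : x \in xs -> generated beta xs x
| gen_add x y : generated beta xs x -> generated beta xs y ->
    generated beta xs (x + y)
| gen_mul x y : generated beta xs x -> generated beta xs y ->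
    generated beta xs (x * y).

(** The graph of the multivalued map that extends [beta r |-> phi r] by sending
    each generator to its prescribed image.  It is an honest ring homomorphism
    once 0 has no other value than 0. *)
Inductive joint_value (R : nzRingType) (beta : R -> S) (phi : R -> K)
    (zs : seq (S * K)) : S -> K -> Prop :=
| joint_base r : joint_value beta phi zs (beta r) (phi r)
| joint_var z : z \in zs -> joint_value beta phi zs z.1 z.2
| joint_add x y x' y' : joint_value beta phi zs x y ->
    joint_value beta phi zs x' y' -> joint_value beta phi zs (x + x') (y + y')
| joint_mul x y x' y' : joint_value beta phi zs x y ->
    joint_value beta phi zs x' y' -> joint_value beta phi zs (x * x') (y * y').

(** Adjoin the generators one after the other, with R[x] as the new base; the
    element [s1] of R[x] that the tail of the list asks not to be killed is the
    [s] of [extend_to_one_generator]. *)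
Lemma extend_to_generators (xs : seq S) (R : comNzRingType)
    (beta : {rmorphism R -> S}) (s : S) :
  generated beta xs s -> s != 0 ->
  exists r : R, beta r != 0 /\ forall phi : {rmorphism R -> K},
    (forall r', beta r' = 0 -> phi r' = 0) -> phi r != 0 ->
    exists zs : seq (S * K),
      [/\ unzip1 zs = xs,
          forall y, joint_value beta phi zs 0 y -> y = 0
        & forall y, joint_value beta phi zs s y -> y != 0].
Proof.
elim: xs R beta s => [|x xs IH] R beta s gens s0.
  have [r sE] : exists r, s = beta r.
    elim: gens => [r|//|_ _ _ [r ->] _ [r' ->]|_ _ _ [r ->] _ [r' ->]].
    - by exists r.
    - by exists (r + r'); rewrite rmorphD.
    - by exists (r * r'); rewrite rmorphM.
  exists r; rewrite -sE; split=> // phi ker phir; exists [::].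
  have joint0 t y : joint_value beta phi [::] t y -> exists2 r', t = beta r' & y = phi r'.
    elim=> [r'|//|t1 y1 t2 y2 _ [r1 -> ->] _ [r2 -> ->]|t1 y1 t2 y2 _ [r1 -> ->] _ [r2 -> ->]].
    - by exists r'.
    - by exists (r1 + r2); rewrite rmorphD.
    - by exists (r1 * r2); rewrite rmorphM.
  split=> // y /joint0[r' e ->]; first by apply: ker.
  have /ker : beta (r' - r) = 0 by rewrite rmorphB -e sE subrr.
  by rewrite rmorphB => /eqP; rewrite subr_eq0 => /eqP ->.
have cx : commr_rmorph beta x by move=> r; apply: mulrC.
pose beta1 : {rmorphism {poly R} -> S} := horner_morph cx.
have gens1 : generated beta1 xs s.
  elim: gens => [r|t|t t' _ g _ g'|t t' _ g _ g'].
  - by rewrite -(horner_morphC cx r); apply: (gen_base beta1).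
  - rewrite inE => /predU1P[->|tx]; last by apply: gen_var.
    by rewrite -[X in generated _ _ X](horner_morphX cx); apply: (gen_base beta1).
  - exact: gen_add.
  - exact: gen_mul.
have [s1 [s10 Hs1]] := IH _ beta1 s gens1 s0.
have [r [br Hr]] := extend_to_one_generator s10.
exists r; split=> // phi ker phir; have [xi [ker1 s1xi]] := Hr phi ker phir.
have cxi : commr_rmorph phi xi by move=> r'; apply: mulrC.
pose phi1 : {rmorphism {poly R} -> K} := horner_morph cxi.
have [zs [zsE j0 js]] := Hs1 phi1 ker1 s1xi.
have joint1 t y : joint_value beta phi ((x, xi) :: zs) t y -> joint_value beta1 phi1 zs t y.
  elim=> [r'|z|t1 y1 t2 y2 _ j1 _ j2|t1 y1 t2 y2 _ j1 _ j2].
  - rewrite -(horner_morphC cx r') -(horner_morphC cxi r').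
    exact: (joint_base beta1 phi1).
  - rewrite inE => /predU1P[->|zz]; last by apply: joint_var.
    rewrite -[X in joint_value _ _ _ X](horner_morphX cx).
    rewrite -[X in joint_value _ _ _ _ X](horner_morphX cxi).
    exact: (joint_base beta1 phi1).
  - exact: joint_add.
  - exact: joint_mul.
exists ((x, xi) :: zs); split=> /= [|y|y]; first by rewrite zsE.
- by move/joint1/j0.
- by move/joint1/js.
Qed.

End Extension.

Lemma mpoly_ring_ind (N : nat) (K : comNzRingType) (P : {mpoly K[N]} -> Prop) :
  (forall c, P c%:MP) -> (forall i, P 'X_i) ->
  (forall p q, P p -> P q -> P (p + q)) ->
  (forall p q, P p -> P q -> P (p * q)) -> forall p, P p.
Proof.
move=> PC PX PD PM p; rewrite (mpolyE p).
apply: (big_ind P) => [||m _]; [by rewrite -mpolyC0; apply: PC | exact: PD |].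
rewrite -mul_mpolyC; apply: (PM); first exact: PC.
rewrite mpolyXE_id; apply: (big_ind P) => [||i _].
- by rewrite -mpolyC1; apply: PC.
- exact: PM.
- elim: (m i) => [|k IH]; first by rewrite expr0 -mpolyC1; apply: PC.
  by rewrite exprS; apply: (PM).
Qed.

(** Chevalley's theorem in the form used here: the map from the affine space
    over K to the spectrum of [beta R] hits every K-point off the hypersurface
    r = 0, even with the value of s required to be nonzero. *)
Lemma extension_point (K : closedFieldType) (N : nat) (R : comNzRingType)
    (beta : {rmorphism R -> {mpoly K[N]}}) (iota : K -> R) (s : {mpoly K[N]}) :
  (forall c, beta (iota c) = c%:MP) -> s != 0 ->
  exists r : R, beta r != 0 /\ forall phi : {rmorphism R -> K},
    (forall c, phi (iota c) = c) ->
    (forall r', beta r' = 0 -> phi r' = 0) -> phi r != 0 ->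
    exists v : 'I_N -> K, (forall r', phi r' = (beta r').@[v]) /\ s.@[v] != 0.
Proof.
move=> betaC s0; pose xs : seq {mpoly K[N]} := [seq 'X_i | i <- enum 'I_N].
have gens : generated beta xs s.
  elim/mpoly_ring_ind: s {s0} => [c|i|p q|p q].
  - by rewrite -betaC; apply: gen_base.
  - by apply: gen_var; apply/mapP; exists i; rewrite ?mem_enum.
  - exact: gen_add.
  - exact: gen_mul.
have [r [br Hr]] := extend_to_generators K gens s0.
exists r; split=> // phi phiC ker phir; have [zs [zsE j0 js]] := Hr phi ker phir.
pose v (i : 'I_N) := (nth (0, 0) zs i).2; exists v.
have szs : size zs = N.
  by rewrite -(size_map fst) -[map _ _]/(unzip1 zs) zsE size_map size_enum_ord.
have zsX (i : 'I_N) : (nth (0, 0) zs i).1 = 'X_i.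
  rewrite -(nth_map _ 0) ?szs // -[map _ _]/(unzip1 zs) zsE.
  by rewrite (nth_map i) ?size_enum_ord // nth_ord_enum.
have jv p : joint_value beta phi zs p p.@[v].
  elim/mpoly_ring_ind: p => [c|i|p q|p q].
  - by rewrite mevalC -betaC -[X in joint_value _ _ _ _ X]phiC; apply: joint_base.
  - by rewrite mevalXU -zsX; apply: joint_var; apply: mem_nth; rewrite szs.
  - by rewrite mevalD; apply: joint_add.
  - by rewrite mevalM; apply: joint_mul.
split=> [r'|]; last by apply: js.
apply/eqP; rewrite -subr_eq0; apply/eqP/j0.
rewrite -(subrr (beta r')) -[X in _ - X]mul1r -mulNr.
apply: joint_add; first exact: joint_base.
rewrite -[X in joint_value _ _ _ _ X]mulN1r; apply: joint_mul => //.
by have := jv (- 1%:MP); rewrite mevalN mevalC mpolyC1.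
Qed.

Lemma nonzero_value (K : closedFieldType) (N : nat) (p : {mpoly K[N]}) :
  p != 0 -> exists v : 'I_N -> K, p.@[v] != 0.
Proof.
move=> p0; have [|r [r0 H]] := @extension_point K N K (@mpolyC N K) id p _ p0; first by [].
rewrite mpolyC_eq0 in r0.
have [//|r'|//|v [_ pv]] := H idfun _; last by exists v.
by move/eqP; rewrite mpolyC_eq0 => /eqP.
Qed.

(** * Linear algebra *)

Lemma subspace_vspace (K : fieldType) (V : vectType K) (P : V -> Prop) :
  P 0 -> (forall c x y, P x -> P y -> P (c *: x + y)) ->
  exists U : {vspace V}, forall x, x \in U <-> P x.
Proof.
move=> P0 PL.
pose Q n := `[< exists2 U : {vspace V}, (forall x, x \in U -> P x) & \dim U = n >].
have exQ : exists n, Q n.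
  exists 0%N; apply/asboolP; exists 0%VS; last exact: dimv0.
  by move=> x; rewrite memv0 => /eqP ->.
have leQ n : Q n -> (n <= \dim {:V})%N.
  by case/asboolP=> U _ <-; apply/dimvS/subvf.
case: (ex_maxnP exQ leQ) => n /asboolP[U UP dU] max; exists U => x.
split=> [|Px]; first exact: UP.
apply: contrapT => /negP xU.
have : Q (\dim (U + <[x]>)%VS).
  apply/asboolP; exists (U + <[x]>)%VS => // y /memv_addP[u /UP Pu [w]].
  by case/vlineP=> k -> ->; rewrite addrC; apply: PL.
move/max; rewrite -dU leqNgt => /negP; apply.
rewrite ltn_neqAle dimvS ?addvSl // andbT; apply: contra xU => /eqP dE.
have /eqP -> : U == (U + <[x]>)%VS by rewrite eqEdim addvSl dE leqnn.
by apply: (subvP (addvSr _ _)); apply: memv_line.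
Qed.

Lemma annihilator_of_proper (K : fieldType) (n : nat) (U : {vspace 'cV[K]_n}) :
  U <> fullv -> exists2 x : 'rV_n, x != 0 & forall u, u \in U -> x *m u = 0.
Proof.
move=> /eqP Uf; pose A : 'M[K]_(n, \dim U) := \matrix_(i, j) (vbasis U)`_j i 0.
have ltU : (\dim U < n)%N.
  have := dimvS (subvf U); rewrite dimvf dim_matrix mulr1 => le.
  rewrite ltn_neqAle le andbT; apply: contra Uf => /eqP e.
  by rewrite eqEdim subvf /= dimvf dim_matrix mulr1 e.
have : kermx A != 0.
  by rewrite kermx_eq0 /row_free neq_ltn (leq_ltn_trans (rank_leq_col A)).
case/rowV0Pn => x /sub_kermxP xA x0; exists x => // u uU.
have -> : u = A *m \col_j coord (vbasis U) j u.
  rewrite {1}(coord_vbasis uU); apply/colP => i; rewrite summxE mxE.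
  by apply: eq_bigr => j _; rewrite !mxE mulrC.
by rewrite mulmxA xA mul0mx.
Qed.

(** A nonzero T of least rank in M satisfies T S T = l T for every S in M: for
    an eigenvalue l of S T on the row space of T, the element T S T - l T has
    smaller rank.  By irreducibility T then has rank one, and multiplying T by
    elements of M on both sides gives all matrices of rank one. *)
Lemma burnside (K : closedFieldType) (n : nat) (M : 'M[K]_n -> Prop) :
  M 1%:M -> (forall c a b, M a -> M b -> M (c *: a + b)) ->
  (forall a b, M a -> M b -> M (a *m b)) ->
  (forall x y : 'rV_n, x != 0 -> exists2 a, M a & x *m a = y) ->
  forall a, M a.
Proof.
move=> M1 ML MM irr.
have M0 : M 0 by rewrite -(addNr 1%:M) -scaleN1r; apply: ML.
case: n M M1 ML MM irr M0 => [|n] M M1 ML MM irr M0 a.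
  by rewrite (flatmx0 a) -(flatmx0 1%:M).
have MB c b d : M b -> M d -> M (b - c *: d).
  by move=> Mb Md; rewrite addrC -scaleNr; apply: ML.
pose Q r := `[< exists T, [/\ M T, T != 0 & \rank T = r] >].
have exQ : exists r, Q r.
  exists (\rank (1%:M : 'M[K]_n.+1)); apply/asboolP; exists 1%:M.
  by split=> //; rewrite oner_eq0.
case: (ex_minnP exQ) => r /asboolP[T [MT T0 rT]] minr.
have TST S : M S -> exists l, T *m S *m T = l *: T.
  move=> MS; pose R := row_base T; pose P := R *m S *m T *m pinvmx R.
  have PR : P *m R = R *m S *m T.
    by rewrite mulmxKpV // eq_row_base submxMl.
  have /closed_rootP[l] : size (char_poly P) != 1%N.
    by rewrite size_char_poly eqSS mxrank_eq0.
  rewrite -eigenvalue_root_char => /eigenvalueP[v vP v0].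
  exists l; apply/eqP; rewrite -subr_eq0; apply/negPn/negP => D0.
  have DE : T *m S *m T - l *: T = T *m (S *m T - l%:M).
    by rewrite mulmxBr mulmxA mul_mx_scalar.
  have : Q (\rank (T *m S *m T - l *: T)).
    by apply/asboolP; exists (T *m S *m T - l *: T); split=> //; apply/MB/MT/MM/MT/MM.
  move/minr; rewrite leqNgt => /negP; apply; rewrite DE -rT.
  rewrite -[X in (_ < X)%N](mxrank_mul_ker T (S *m T - l%:M)).
  rewrite -[X in (X < _)%N]addn0 ltn_add2l lt0n mxrank_eq0.
  apply/rowV0Pn; exists (v *m R); last first.
    by apply: contra v0 => /eqP e; rewrite -(mulmx_free_eq0 _ (row_base_free T)) e.
  rewrite sub_capmx (submx_trans (submxMl _ _)) ?eq_row_base //=.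
  apply/sub_kermxP; rewrite mulmxBr mul_mx_scalar -[v *m R *m _]mulmxA.
  by rewrite [R *m (S *m T)]mulmxA -PR mulmxA vP scalemxAl subrr.
have [x xT] : exists x : 'rV_n.+1, x *m T != 0.
  have [i ri] : exists i, row i T != 0.
    apply: contrapT => ne; case/negP: T0; apply/eqP/row_matrixP => i; rewrite row0.
    by apply: contra_notP ne => /eqP; exists i.
  by exists (delta_mx 0 i); rewrite -rowE.
have x0 : x != 0 by apply: contraNneq xT => ->; rewrite mul0mx.
have /submxP[u Tu] : (T <= x *m T)%MS.
  apply/row_subP => i; have [S MS xS] := irr (x *m T) (row i 1%:M) xT.
  have [l Tl] := TST S MS; rewrite -[T in row i T]mul1mx row_mul -xS.
  by rewrite -!mulmxA [T *m (S *m T)]mulmxA Tl -scalemxAr scalemx_sub.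
pose Pc (c : 'cV[K]_n.+1) := forall y : 'rV_n.+1, M (c *m y).
have [U UP] : exists U : {vspace 'cV[K]_n.+1}, forall c, c \in U <-> Pc c.
  apply: subspace_vspace => [y|k c d Pcc Pcd y]; first by rewrite mul0mx.
  by rewrite mulmxDl -scalemxAl; apply: ML.
have uU : Pc u.
  move=> y; have [S MS <-] := irr _ y xT.
  by rewrite mulmxA -Tu; apply: MM.
have Uf : U = fullv.
  apply: contrapT => /annihilator_of_proper[z z0 zU].
  have [i ui] : exists i, u i 0 != 0.
    apply: contrapT => ne; case/negP: T0; rewrite Tu (_ : u = 0) ?mul0mx //.
    apply/colP => i; rewrite [RHS]mxE.
    by apply: contra_notP ne => /eqP; exists i.
  have [S MS zS] := irr z (delta_mx 0 i) z0.
  have /zU : S *m u \in U by apply/UP => y; rewrite -mulmxA; apply/MM/uU.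
  rewrite mulmxA zS -rowE => /matrixP /(_ 0 0); rewrite !mxE => ui0.
  by rewrite ui0 eqxx in ui.
have rank1 c (y : 'rV_n.+1) : M (c *m y) by apply: (UP c).1; rewrite Uf memvf.
rewrite (matrix_sum_delta a); apply: big_ind => [//|b d Mb Md|i _].
  by rewrite -[b]scale1r; apply: ML.
apply: big_ind => [//|b d Mb Md|j _]; first by rewrite -[b]scale1r; apply: ML.
rewrite -[_ *: _]addr0; apply: ML => //.
by rewrite -(mul_delta_mx (0 : 'I_1)); apply: rank1.
Qed.

Section Multilinear.
Variables (K : fieldType) (V W : lmodType K) (p : nat).
Variable T : {ffun 'I_p -> V} -> W.

Definition multilinear := forall (i : 'I_p) (a : {ffun 'I_p -> V}) (c : K) (x y : V),
  T (upd a i (c *: x + y)) = c *: T (upd a i x) + T (upd a i y).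

Hypothesis T_lin : multilinear.

Lemma upd_id (a : {ffun 'I_p -> V}) i : upd a i (a i) = a.
Proof. by apply/ffunP => j; rewrite ffunE; case: eqP => [->|]. Qed.

Lemma multilinear0 i a : T (upd a i 0) = 0.
Proof.
have := T_lin i a 1 0 0; rewrite scaler0 addr0 scale1r => e.
by apply: (@addrI _ (T (upd a i 0))); rewrite addr0 -e.
Qed.

Lemma multilinear_sum i a (J : finType) (c : J -> K) (y : J -> V) :
  T (upd a i (\sum_j c j *: y j)) = \sum_j c j *: T (upd a i (y j)).
Proof.
apply: (big_rec2 (fun u v => T (upd a i u) = v)) => [|j u v _ <-].
  exact: multilinear0.
by rewrite T_lin.
Qed.

(** Expand one slot at a time: the statement for [k] allows the slots below [k]
    to be arbitrary while the others hold vectors of the family [e]. *)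
Lemma multilinear_expand (J : finType) (e : J -> V) (X : 'I_p -> J -> K) :
  T [ffun i => \sum_k X i k *: e k] =
  \sum_(f : {ffun 'I_p -> J}) (\prod_i X i (f i)) *: T [ffun i => e (f i)].
Proof.
suff main k Y : (k <= p)%N ->
    (forall i : 'I_p, (k <= i)%N -> exists l, forall j, Y i j = (j == l)%:R) ->
    T [ffun i => \sum_k Y i k *: e k] =
    \sum_(f : {ffun 'I_p -> J}) (\prod_i Y i (f i)) *: T [ffun i => e (f i)].
  by apply: (main p) => // i; rewrite leqNgt ltn_ord.
elim: k Y => [|k IH] Y lek Yd.
  have /choice[g Yg'] : forall i, exists l, forall j, Y i j = (j == l)%:R.
    by move=> i; apply: Yd.
  rewrite (bigD1 (finfun g)) //= [X in _ + X]big1 => [|f fg].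
    rewrite addr0 big1 ?scale1r => [|i _]; last by rewrite Yg' ffunE eqxx.
    congr T; apply/ffunP => i; rewrite !ffunE (bigD1 (g i)) //= Yg' eqxx scale1r.
    by rewrite big1 ?addr0 // => j /negbTE ne; rewrite Yg' ne scale0r.
  have [i fi] : exists i, f i != g i.
    apply: contrapT => ne; case/negP: fg; apply/eqP/ffunP => i; rewrite ffunE.
    by apply: contra_notP ne => /eqP; exists i.
  by rewrite (bigD1 i) //= Yg' (negbTE fi) mul0r scale0r.
pose i0 := Ordinal lek.
pose Y' j i l := if i == i0 then (l == j)%:R else Y i l.
have E : [ffun i => \sum_k Y i k *: e k] =
    upd [ffun i => \sum_k Y i k *: e k] i0 (\sum_k Y i0 k *: e k).
  by rewrite -[in RHS](ffunE (fun i => \sum_k Y i k *: e k)) upd_id.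
rewrite E multilinear_sum.
have E' j : T (upd [ffun i => \sum_k Y i k *: e k] i0 (e j)) =
    \sum_(f : {ffun 'I_p -> J}) (\prod_i Y' j i (f i)) *: T [ffun i => e (f i)].
  rewrite -IH ?(ltnW lek) //; last first.
    move=> i lei; rewrite /Y'; case: eqP => [_|/eqP ne]; first by exists j.
    apply: Yd; rewrite ltn_neqAle lei andbT.
    by apply: contra ne => /eqP e0; apply/eqP/val_inj.
  congr T; apply/ffunP => i; rewrite !ffunE /Y'; case: eqP => // _.
  rewrite (bigD1 j) //= eqxx scale1r big1 ?addr0 // => l /negbTE ->.
  by rewrite scale0r.
under eq_bigr => j _ do rewrite E' scaler_sumr.
rewrite exchange_big /=; apply: eq_bigr => f _.
under eq_bigr => j _ do rewrite scalerA.
rewrite -scaler_suml; congr (_ *: _).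
rewrite [RHS](bigD1 i0) //= (bigD1 (f i0)) //= [X in _ + X]big1 => [|j ne].
  rewrite addr0 (bigD1 i0) //= /Y' !eqxx mul1r; congr (_ * _).
  by apply: eq_bigr => i /negbTE ->.
by rewrite (bigD1 i0) //= /Y' eqxx eq_sym (negbTE ne) mul0r mulr0.
Qed.

End Multilinear.

Definition alternation (K : fieldType) (V W : lmodType K) (n : nat)
    (T : {ffun 'I_n -> V} -> W) (x : 'I_n -> V) : W :=
  \sum_(s : 'S_n) (-1) ^+ s *: T [ffun i => x (s i)].

(** The family [e] may be dependent, so the formula also forces alternations in
    [n] arguments to vanish on spaces of dimension less than [n]. *)
Lemma alternation_det (K : fieldType) (V W : lmodType K) (n : nat)
    (T : {ffun 'I_n -> V} -> W) (X : 'M[K]_n) (e x : 'I_n -> V) :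
  multilinear T -> (forall i, x i = \sum_k X i k *: e k) ->
  alternation T x = \det X *: alternation T e.
Proof.
move=> T_lin xE; rewrite /alternation.
pose F (f : {ffun 'I_n -> 'I_n}) := \det (\matrix_(i, j) X j (f i)).
transitivity (\sum_(f : {ffun 'I_n -> 'I_n}) F f *: T [ffun i => e (f i)]).
  have E (s : 'S_n) : T [ffun i => x (s i)] =
      \sum_(f : {ffun 'I_n -> 'I_n}) (\prod_i X (s i) (f i)) *: T [ffun i => e (f i)].
    rewrite -(multilinear_expand T_lin e (fun i => X (s i))).
    by congr T; apply/ffunP => i; rewrite !ffunE xE.
  under eq_bigr => s _ do rewrite E scaler_sumr.
  rewrite exchange_big /=; apply: eq_bigr => f _; rewrite /F /determinant.
  rewrite scaler_suml; apply: eq_bigr => s _; rewrite scalerA; congr (_ * _ *: _).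
  by apply: eq_bigr => i _; rewrite mxE.
rewrite (bigID (fun f : {ffun 'I_n -> 'I_n} => injectiveb f)) /= addrC big1 ?add0r.
  rewrite (reindex (@pval _)) /=; last first.
    pose in_Sn := insubd (1%g : 'S_n).
    by exists in_Sn => /= f Uf; first apply: val_inj; apply: insubdK.
  rewrite scaler_sumr; apply: eq_big => [s|s _]; first exact: (valP s).
  rewrite scalerA; congr (_ *: T _); last first.
    by apply/ffunP => i; rewrite !ffunE -pvalE.
  rewrite /F -(det_tr X) mulrC.
  rewrite (_ : \matrix_(i, j) _ = perm_mx s *m X^T) ?det_mulmx ?det_perm //.
  by rewrite -row_permE; apply/matrixP => i j; rewrite !mxE -pvalE.
move=> f /injectivePn[i [j ij fij]].
rewrite /F (determinant_alternate ij) ?scale0r // => l.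
by rewrite !mxE fij.
Qed.

(** * Homogeneous components *)

Section SeqSums.
Variables (K : fieldType) (A : vectType K) (I : eqType) (V : I -> {vspace A}).

Lemma memv_sum_seq (s : seq I) (u : I -> A) :
  (forall i, u i \in V i) -> \sum_(i <- s) u i \in (\sum_(i <- s) V i)%VS.
Proof.
move=> uV; elim: s => [|i s IH]; first by rewrite !big_nil mem0v.
by rewrite !big_cons memv_add.
Qed.

Lemma memv_sum_of (s : seq I) i a :
  i \in s -> a \in V i -> a \in (\sum_(j <- s) V j)%VS.
Proof.
elim: s => [//|j s IH]; rewrite inE big_cons => /orP[/eqP <-|/IH h] aV.
  exact: (subvP (addvSl _ _)).
by apply: (subvP (addvSr _ _)); apply: h.
Qed.

Lemma directv_cons (i : I) (s : seq I) :
  directv (\sum_(j <- i :: s) V j) -> directv (\sum_(j <- s) V j) ->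
  (V i :&: \sum_(j <- s) V j)%VS = 0%VS.
Proof.
rewrite !directvE /= !big_cons => /eqP d1 /eqP d2; apply/eqP; rewrite -dimv_eq0.
by rewrite -(eqn_add2l (\dim (V i + \sum_(j <- s) V j)%VS)) dimv_sum_cap d1 addn0 d2.
Qed.

Lemma directv_seq (s : seq I) :
  (forall i s, uniq (i :: s) -> (V i :&: \sum_(j <- s) V j)%VS = 0%VS) ->
  uniq s -> directv (\sum_(j <- s) V j).
Proof.
move=> disj; rewrite directvE /=; elim: s => [|i s IH us].
  by rewrite !big_nil dimv0.
have /eqP e := IH (proj2 (andP us)).
have d0 : \dim (V i :&: \sum_(j <- s) V j)%VS = 0%N by rewrite disj ?dimv0.
by rewrite !big_cons -e -dimv_sum_cap d0 addn0.
Qed.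

End SeqSums.

Section GradedAlgebra.
Variables (Omega : nat -> Type) (K : fieldType) (G : semigroupType).
Variables (deg0 : Omega 0%N -> G) (A : grOmegaAlgType K deg0).

Lemma gr_disjoint g s : uniq (g :: s) ->
  (grcomp A g :&: \sum_(h <- s) grcomp A h)%VS = 0%VS.
Proof.
have [_ D] := @gr_direct_sum _ _ _ _ A => us.
by apply: directv_cons; apply: D => //; case/andP: us.
Qed.

Lemma gr_finite_support :
  exists2 s : seq G, uniq s & fullv = (\sum_(g <- s) grcomp A g)%VS.
Proof.
have [full _] := @gr_direct_sum _ _ _ _ A.
have /choice[S HS] a : exists s : seq G, a \in (\sum_(g <- s) grcomp A g)%VS.
  by have [s [_ ?]] := (full a).1 (memvf a); exists s.
pose s := undup (flatten [seq S b | b <- vbasis {:A}]); exists s.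
  exact: undup_uniq.
apply/eqP; rewrite eqEsubv subvf andbT -(span_basis (vbasisP {:A})).
apply/span_subvP => b bA; have sub : {subset S b <= s}.
  move=> g gb; rewrite mem_undup; apply/flattenP; exists (S b) => //.
  exact: map_f.
apply: subvP (HS b); elim: (S b) sub => [|g r IH] sub; first by rewrite big_nil sub0v.
rewrite big_cons subv_add IH ?andbT => [|h hr]; last by rewrite sub // inE hr orbT.
by apply/subvP => x; apply: memv_sum_of; rewrite sub // mem_head.
Qed.

Definition gsupp : seq G := s2val (cid2 gr_finite_support).

Lemma gsupp_uniq : uniq gsupp.
Proof. by rewrite /gsupp; case: cid2. Qed.

Lemma gsupp_full : fullv = (\sum_(g <- gsupp) grcomp A g)%VS.
Proof. by rewrite /gsupp; case: cid2. Qed.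

Lemma gr_outside_support g a : g \notin gsupp -> a \in grcomp A g -> a = 0.
Proof.
move=> gs ag; apply/eqP; rewrite -memv0 -(@gr_disjoint g gsupp).
  by rewrite memv_cap ag -gsupp_full memvf.
by rewrite /= gs gsupp_uniq.
Qed.

(** Degrees off the support need no case distinction: there the component, and
    with it the projection, is zero. *)
Definition gproj (g : G) : {linear A -> A} := sumv_pi_for gsupp_full g.

Lemma gproj_mem g a : gproj g a \in grcomp A g.
Proof. exact: memv_sum_pi. Qed.

Lemma gproj_sum s a : uniq s -> {subset gsupp <= s} ->
  \sum_(g <- s) gproj g a = a.
Proof.
move=> us sub; rewrite -[RHS](sumv_pi_uniq_sum gsupp_full (v := a)) ?memvf //; last first.
  by rewrite filter_predT gsupp_uniq.
rewrite (bigID (mem gsupp)) /= [X in _ + X]big1 ?addr0 => [|g gs]; last first.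
  exact: gr_outside_support gs (gproj_mem _ _).
rewrite -big_filter; apply: perm_big; apply: uniq_perm.
- exact: filter_uniq.
- exact: gsupp_uniq.
by move=> g; rewrite mem_filter andbC; apply: andb_idl; apply: sub.
Qed.

Lemma homogeneous_sum_eq0 s (u : G -> A) : uniq s ->
  (forall g, u g \in grcomp A g) -> \sum_(g <- s) u g = 0 ->
  forall g, g \in s -> u g = 0.
Proof.
move=> us uA; elim: s us => [//|h s IH] us; rewrite big_cons => e0.
have uh : u h = 0.
  apply/eqP; rewrite -memv0 -(gr_disjoint us) memv_cap uA /=.
  have -> : u h = - \sum_(g <- s) u g by apply/eqP; rewrite -addr_eq0 e0.
  by rewrite memvN memv_sum_seq.
move=> g; rewrite inE => /predU1P[-> //|]; apply: IH; first by case/andP: us.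
by move: e0; rewrite uh add0r.
Qed.

Lemma gproj_hom g h a : a \in grcomp A h -> gproj g a = if g == h then a else 0.
Proof.
move=> ah; pose s := undup (g :: h :: gsupp).
have us : uniq s by apply: undup_uniq.
have sub : {subset gsupp <= s} by move=> k ks; rewrite mem_undup !inE ks !orbT.
have hs : h \in s by rewrite mem_undup !inE eqxx orbT.
have gs : g \in s by rewrite mem_undup !inE eqxx.
pose u k := gproj k a - (if k == h then a else 0).
apply/eqP; rewrite -subr_eq0; apply/eqP; rewrite -/(u g).
apply: (@homogeneous_sum_eq0 s) => // [k|].
  by rewrite rpredB ?gproj_mem //; case: eqP => [->|]; rewrite ?mem0v.
rewrite sumrB gproj_sum // (bigD1_seq h) //= eqxx big1 ?addr0 ?subrr //.
by move=> k /negbTE ->.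
Qed.

Lemma omega_multilinear m (w : Omega m) : multilinear (fun a : {ffun 'I_m -> A} => oapp w a).
Proof. by move=> i a c x y; apply: oapp_multilinear. Qed.

Lemma gr_ideal_of_proj (U : {vspace A}) : omega_ideal U ->
  (forall g a, a \in U -> gproj g a \in U) -> graded_ideal U.
Proof.
move=> idU projU; split=> //; split.
  move=> a; split=> [aU|[s [us]]].
    exists gsupp; split; first exact: gsupp_uniq.
    rewrite -(gproj_sum a gsupp_uniq) //.
    by apply: memv_sum_seq => g; rewrite memv_cap projU ?gproj_mem.
  apply: subvP; elim: s us => [|g s IH] us; first by rewrite big_nil sub0v.
  by rewrite big_cons subv_add capvSl IH //; case/andP: us.
have sub r : (\sum_(h <- r) (U :&: grcomp A h) <= \sum_(h <- r) grcomp A h)%VS.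
  elim: r => [|h r IH]; first by rewrite !big_nil subvv.
  by rewrite !big_cons addvS ?capvSr.
move=> s; apply: directv_seq => g r ur; apply/vspaceP => x; rewrite memv0.
apply/idP/eqP => [|->]; last by rewrite mem0v.
rewrite !memv_cap => /andP[/andP[_ xg]] /(subvP (sub r)) xr.
by apply/eqP; rewrite -memv0 -(gr_disjoint ur) memv_cap xg xr.
Qed.

End GradedAlgebra.

(** * Terms *)

Section Terms.
Variables (Omega : nat -> Type) (K : fieldType) (G : semigroupType).
Variable (V : Type).

(** Linear combinations and projections are part of the syntax, so that every
    element of the algebra is the value of a term as soon as the variables
    take spanning values. *)
Inductive term : Type :=
| TVar of V
| TOp m (w : Omega m) of 'I_m -> term
| TProj of G & term
| TZero
| TLin of K & term & term.

(** Closing contexts under linear combinations makes their values at a given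
    assignment an algebra of operators. *)
Inductive ctx : Type :=
| Hole
| COp m (w : Omega m) (i : 'I_m) of 'I_m -> term & ctx
| CProj of G & ctx
| CLin of K & ctx & ctx.

Fixpoint plug (c : ctx) (u : term) : term :=
  match c with
  | Hole => u
  | COp m w i t c => TOp w (fun j => if j == i then plug c u else t j)
  | CProj g c => TProj g (plug c u)
  | CLin k c d => TLin k (plug c u) (plug d u)
  end.

Fixpoint ccomp (c d : ctx) : ctx :=
  match c with
  | Hole => d
  | COp m w i t c => COp w i t (ccomp c d)
  | CProj g c => CProj g (ccomp c d)
  | CLin k c c' => CLin k (ccomp c d) (ccomp c' d)
  end.

Variables (deg0 : Omega 0%N -> G) (A : grOmegaAlgType K deg0).
Implicit Types (a : V -> A).

Fixpoint tev a (t : term) : A :=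
  match t with
  | TVar v => a v
  | TOp m w t => oapp w [ffun i => tev a (t i)]
  | TProj g t => gproj A g (tev a t)
  | TZero => 0
  | TLin k t u => k *: tev a t + tev a u
  end.

Fixpoint cev a (c : ctx) (x : A) : A :=
  match c with
  | Hole => x
  | COp m w i t c => oapp w (upd [ffun j => tev a (t j)] i (cev a c x))
  | CProj g c => gproj A g (cev a c x)
  | CLin k c d => k *: cev a c x + cev a d x
  end.

Lemma cev_lin a c k x y : cev a c (k *: x + y) = k *: cev a c x + cev a c y.
Proof.
elim: c => [//|m w i t c IH|g c IH|l c IHc d IHd] /=.
- by rewrite IH oapp_multilinear.
- by rewrite IH linearP.
- by rewrite IHc IHd !scalerDr !scalerA addrACA mulrC.
Qed.

HB.instance Definition _ a c := @GRing.isLinear.Build K A A _ (cev a c) (cev_lin a c).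

Lemma tev_plug a c t : tev a (plug c t) = cev a c (tev a t).
Proof.
elim: c => [//|m w i u c IH|g c IH|l c IHc d IHd] /=.
- congr oapp; apply/ffunP => j; rewrite !ffunE; case: eqP => // _.
- by rewrite IH.
- by rewrite IHc IHd.
Qed.

Lemma cev_comp a c d x : cev a (ccomp c d) x = cev a c (cev a d x).
Proof.
elim: c => [//|m w i u c IH|g c IH|l c IHc c' IHc'] /=.
- by rewrite IH.
- by rewrite IH.
- by rewrite IHc IHc'.
Qed.

(** The values c(x) form a subspace stable under all operations and under the
    projections, that is, a graded ideal. *)
Lemma ctx_irreducible a (x y : A) : gr_simple A ->
  (forall z, exists t, tev a t = z) -> x <> 0 -> exists c, cev a c x = y.
Proof.
move=> [_ simple] gen x0.
have [||U UP] := @subspace_vspace K A (fun z => exists c, cev a c x = z).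
- by exists (CLin (-1) Hole Hole); rewrite /= scaleN1r addNr.
- by move=> k _ _ [c <-] [d <-]; exists (CLin k c d).
suff /simple[U0|Uf] : graded_ideal U.
- case: x0; apply/eqP; rewrite -memv0 -U0; apply/UP; by exists Hole.
- by apply/UP; rewrite Uf memvf.
apply: gr_ideal_of_proj => [m w b i /UP[c cb]|g z /UP[c cz]]; apply/UP; last first.
  by exists (CProj g c); rewrite /= cz.
have /choice[t tb] : forall j, exists t, tev a t = b j by move=> j; apply: gen.
exists (COp w i t c) => /=; congr oapp; apply/ffunP => j; rewrite !ffunE.
by case: eqP => [->|].
Qed.

End Terms.

Arguments TVar {Omega K G V}.
Arguments TZero {Omega K G V}.
Arguments Hole {Omega K G V}.

(** * Terms as graded polynomials *)

Section FreeAlgebra.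
Import monalg.
Local Notation "g @_ k" := (mcoeff k g) : ring_scope.
Variables (Omega : nat -> Type) (K : fieldType) (G : semigroupType).
Variables (deg0 : Omega 0%N -> G) (X : Type).
Local Notation M := (omonom Omega (X * G)).
Local Notation F := (free_omega Omega K (X * G)).

(** The induction principle generated for [omonom] does not reach the monomials
    stored in a finite function. *)
Lemma omonom_nested_ind (Y : Type) (P : omonom Omega Y -> Prop) :
  (forall v, P (OVar Omega v)) ->
  (forall m (w : Omega m) (t : {ffun 'I_m -> omonom Omega Y}),
     (forall i, P (t i)) -> P (OApp w t)) -> forall k, P k.
Proof.
move=> PV PA; exact: (fix IH k := match k with
  | OVar v => PV v
  | OApp m w t => PA m w t (fun i => IH (t i))
  end).
Qed.

Definition op_degree m : Omega m -> ('I_m -> G) -> G :=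
  match m with
  | 0 => fun w _ => deg0 w
  | m'.+1 => fun _ d => sgprod d
  end.

Fixpoint mdegree (k : M) : G :=
  match k with
  | OVar v => v.2
  | OApp m w t => op_degree w (fun i => mdegree (t i))
  end.

(** The operation on graded polynomials that induces [gproj] on values. *)
Definition fproj (g : G) (f : F) : F :=
  \sum_(k <- msupp f | mdegree k == g) f@_k *: << k >>.

Variable A : grOmegaAlgType K deg0.

Lemma op_degreeP m (w : Omega m) (d : 'I_m -> G) (a : {ffun 'I_m -> A}) :
  (forall i, a i \in grcomp A (d i)) -> oapp w a \in grcomp A (op_degree w d).
Proof.
case: m w d a => [|m] w d a ad; first exact: gr_nullary.
exact: gr_homogeneous.
Qed.

Definition gr_assignment (phi : {linear F -> A}) : Prop := omega_morphism phi /\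
  forall x g, phi (ofree_var Omega K (x, g)) \in grcomp A g.

Lemma gr_assignment_monom phi k : gr_assignment phi ->
  phi << k >> \in grcomp A (mdegree k).
Proof.
case=> morph var; elim/omonom_nested_ind: k => [[x g]|m w t IH]; first exact: var.
rewrite -ofree_app_monom morph; apply: op_degreeP => i.
by rewrite !ffunE.
Qed.

Lemma malg_sum (f : F) : f = \sum_(k <- msupp f) f@_k *: << k >>.
Proof.
rewrite {1}(monalgE f); apply: eq_bigr => k _; apply/malgP => l.
by rewrite mcoeffZ !mcoeffU mulr_natr.
Qed.

Lemma gr_assignment_proj phi g f : gr_assignment phi ->
  phi (fproj g f) = gproj A g (phi f).
Proof.
move=> ass; rewrite {2}(malg_sum f) !linear_sum /= big_mkcond /=.
apply: eq_bigr => k _; rewrite !linearZ /= (gproj_hom _ (gr_assignment_monom _ ass)).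
by rewrite eq_sym; case: eqP => _; rewrite ?scaler0.
Qed.

Section Lift.
Variable h : X * G -> A.

Fixpoint mval (k : M) : A :=
  match k with
  | OVar v => h v
  | OApp m w t => oapp w [ffun i => mval (t i)]
  end.

Definition lift_assignment (f : F) : A := \sum_(k <- msupp f) f@_k *: mval k.

Lemma lift_assignmentE (D : {fset M}) (f : F) : (msupp f `<=` D)%fset ->
  lift_assignment f = \sum_(k <- D) f@_k *: mval k.
Proof.
move=> sub; rewrite /lift_assignment; apply: big_fset_incl => // k _ kf.
by rewrite mcoeff_outdom ?scale0r.
Qed.

Lemma lift_assignment_lin k x y :
  lift_assignment (k *: x + y) = k *: lift_assignment x + lift_assignment y.
Proof.
pose D := (msupp x `|` msupp y)%fset.
rewrite !(@lift_assignmentE D) ?fsubsetUl ?fsubsetUr //; last first.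
  apply: fsubset_trans (msuppD_le _ _) _; apply: fsetSU; exact: msuppZ_le.
rewrite scaler_sumr -big_split /=; apply: eq_bigr => l _.
by rewrite mcoeffD mcoeffZ scalerDl scalerA.
Qed.

HB.instance Definition _ :=
  @GRing.isLinear.Build K F A _ lift_assignment lift_assignment_lin.

Lemma lift_assignment_monom k c : lift_assignment << c *g k >> = c *: mval k.
Proof.
by rewrite (@lift_assignmentE [fset k]%fset) ?msuppU_le // big_seq_fset1 mcoeffUU.
Qed.

Lemma lift_assignment_morphism : omega_morphism lift_assignment.
Proof.
move=> m w f /=; rewrite {1}/oapp /= /ofree_app /=.
set D := (\bigcup_(i <- enum 'I_m) msupp (f i))%fset.
rewrite linear_sum /=; under eq_bigr => u _ do rewrite lift_assignment_monom /=.
have -> : [ffun i => lift_assignment (f i)] =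
    [ffun i => \sum_(k : D) (f i)@_(val k) *: mval (val k)].
  apply/ffunP => i; rewrite !ffunE (@lift_assignmentE D) ?big_seq_fsetE //.
  by apply/fsubsetP => k kf; apply/bigfcupP; exists i; rewrite ?mem_enum.
rewrite (multilinear_expand (@omega_multilinear _ _ _ _ A m w)).
apply: eq_bigr => u _; congr (_ *: oapp w _).
by apply/ffunP => i; rewrite !ffunE.
Qed.

End Lift.

End FreeAlgebra.

Section TermPolynomial.
Variables (Omega : nat -> Type) (K : fieldType) (G : semigroupType).
Variables (deg0 : Omega 0%N -> G) (X V : Type) (iota : V -> X).
Hypothesis iota_inj : injective iota.
Variable support : seq G.

(** A graded variable only takes homogeneous values, so a variable of a term
    stands for a sum of graded variables over the degrees that occur in the
    algebras considered. *)
Fixpoint term_poly (t : term Omega K G V) : free_omega Omega K (X * G) :=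
  match t with
  | TVar v => \sum_(g <- support) ofree_var Omega K (iota v, g)
  | TOp m w t => oapp w [ffun i => term_poly (t i)]
  | TProj g t => fproj deg0 g (term_poly t)
  | TZero => 0
  | TLin k t u => k *: term_poly t + term_poly u
  end.

Variable A : grOmegaAlgType K deg0.

Lemma term_polyE (phi : {linear free_omega Omega K (X * G) -> A}) t :
  gr_assignment phi ->
  phi (term_poly t) =
  tev (fun v => \sum_(g <- support) phi (ofree_var Omega K (iota v, g))) t.
Proof.
move=> ass; elim: t => [v|m w t IH|g t IH||k t IHt u IHu] /=.
- by rewrite linear_sum.
- by rewrite ass.1; congr oapp; apply/ffunP => i; rewrite !ffunE.
- by rewrite (gr_assignment_proj _ _ ass) IH.
- by rewrite linear0.
- by rewrite linearP IHt IHu.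
Qed.

Hypotheses (support_uniq : uniq support) (supportA : {subset gsupp A <= support}).

(** The graded variable of degree g is sent to the component of degree g of
    the wanted value. *)
Lemma gr_assignment_of (a : V -> A) : exists2 phi : {linear free_omega Omega K (X * G) -> A},
  gr_assignment phi &
  forall v, \sum_(g <- support) phi (ofree_var Omega K (iota v, g)) = a v.
Proof.
pose ext x := if pselect (exists v, iota v = x) is left e then a (projT1 (cid e)) else 0.
have extE v : ext (iota v) = a v.
  rewrite /ext; case: pselect => [e|[]]; last by exists v.
  by case: cid => u /iota_inj /= ->.
pose h (y : X * G) : A := gproj A y.2 (ext y.1).
have hE y : lift_assignment h (ofree_var Omega K y) = h y.
  by rewrite /ofree_var lift_assignment_monom scale1r.
exists (lift_assignment h) => [|v].
  by split=> [|x g]; [apply: lift_assignment_morphism | rewrite /= hE gproj_mem].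
by rewrite /=; under eq_bigr => g _ do rewrite hE /h /= extE; apply: gproj_sum.
Qed.

Lemma gr_identity_term t :
  gr_identity A (term_poly t) <-> forall a : V -> A, tev a t = 0.
Proof.
split=> [id0 a|id0 phi morph var]; last by rewrite term_polyE.
have [phi ass phiE] := gr_assignment_of a.
have := id0 phi ass.1 ass.2; rewrite term_polyE //.
by congr (_ = 0); congr tev; apply/funext.
Qed.

End TermPolynomial.

Lemma same_term_identities (Omega : nat -> Type) (K : fieldType)
    (G : semigroupType) (deg0 : Omega 0%N -> G) (X V : Type) (iota : V -> X)
    (A B : grOmegaAlgType K deg0) :
  injective iota ->
  (forall f : free_omega Omega K (X * G), gr_identity A f <-> gr_identity B f) ->
  forall t : term Omega K G V,
    (forall a : V -> A, tev a t = 0) <-> (forall b : V -> B, tev b t = 0).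
Proof.
move=> inj same t; pose s := undup (gsupp A ++ gsupp B).
have sA : {subset gsupp A <= s} by move=> g gA; rewrite mem_undup mem_cat gA.
have sB : {subset gsupp B <= s} by move=> g gB; rewrite mem_undup mem_cat gB orbT.
rewrite -(gr_identity_term inj (undup_uniq _) sA) same.
by rewrite (gr_identity_term inj (undup_uniq _) sB).
Qed.

(** Compose the graded homomorphisms into one algebra with the isomorphism or
    with its inverse, which respects degrees because an isomorphism commutes
    with the projections. *)
Lemma isomorphic_same_identities (Omega : nat -> Type) (K : fieldType)
    (G : semigroupType) (deg0 : Omega 0%N -> G) (X : Type)
    (A B : grOmegaAlgType K deg0) (f : free_omega Omega K (X * G)) :
  gr_isomorphic A B -> gr_identity A f <-> gr_identity B f.
Proof.
case=> phi [morph gr bij]; have [psi phiK psiK] := bij.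
have psi_lin : linear psi.
  by move=> k x y; apply: (bij_inj bij); rewrite psiK linearP !psiK.
pose psiL : {linear B -> A} := HB.pack psi (@GRing.isLinear.Build K B A _ psi psi_lin).
have projE g a : phi (gproj A g a) = gproj B g (phi a).
  rewrite -{2}(gproj_sum a (gsupp_uniq A) (fun _ => id)) !linear_sum /=.
  have [gA|gA] := boolP (g \in gsupp A); last first.
    rewrite (gr_outside_support gA (gproj_mem _ _)) linear0 big1_seq // => h /= hA.
    rewrite (gproj_hom _ (gr _ _ (gproj_mem h a))); case: eqP => // e.
    by rewrite -e (negbTE gA) in hA.
  rewrite (bigD1_seq g) ?gsupp_uniq //= (gproj_hom _ (gr _ _ (gproj_mem g a))) eqxx.
  rewrite big1 ?addr0 // => h /negbTE hg.
  by rewrite (gproj_hom _ (gr _ _ (gproj_mem h a))) eq_sym hg.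
split=> id0 chi chi_morph chi_gr.
  have psi_gr g b : b \in grcomp B g -> psi b \in grcomp A g.
    move=> bg; have -> : psi b = gproj A g (psi b); last exact: gproj_mem.
    by apply: (bij_inj bij); rewrite projE psiK (gproj_hom _ bg) eqxx.
  have /(congr1 phi) : (psiL \o chi) f = 0.
    apply: id0 => [m w a|x g] /=; last exact: psi_gr.
    apply: (bij_inj bij); rewrite psiK chi_morph morph; congr oapp.
    by apply/ffunP => i; rewrite !ffunE /= psiK.
  by rewrite /= psiK linear0.
apply: (bij_inj bij); rewrite linear0; apply: (id0 (phi \o chi)) => [m w a|x g] /=.
  by rewrite chi_morph morph; congr oapp; apply/ffunP => i; rewrite !ffunE.
exact: gr.
Qed.

(** * Coordinates *)

Section Coordinates.
Variables (K : fieldType) (A : vectType K) (n : nat) (X : n.-tuple A).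

Definition coord_mx (x : 'I_n -> A) : 'M[K]_n := \matrix_(i, j) coord X j (x i).

Definition op_mx (u : A -> A) : 'M[K]_n := coord_mx (fun i => u X`_i).

Hypothesis basisX : basis_of fullv X.

Lemma coord_sum x : x = \sum_k coord X k x *: X`_k.
Proof. by apply: coord_basis (memvf x). Qed.

Lemma coord_inj x y : (forall j, coord X j x = coord X j y) -> x = y.
Proof.
by move=> e; rewrite [x]coord_sum [y]coord_sum; apply: eq_bigr => j _; rewrite e.
Qed.

Lemma coord_comb (c : 'I_n -> K) j : coord X j (\sum_k c k *: X`_k) = c j.
Proof. by rewrite coord_sum_free // (basis_free basisX). Qed.

Lemma coord_mx_op (u : {linear A -> A}) x :
  coord_mx (fun i => u (x i)) = coord_mx x *m op_mx u.
Proof.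
apply/matrixP => i j; rewrite !mxE {1}[x i]coord_sum !linear_sum /=.
by apply: eq_bigr => k _; rewrite !mxE !linearZ.
Qed.

Lemma op_mx_id : op_mx id = 1%:M.
Proof.
by apply/matrixP => i j; rewrite !mxE coord_free ?(basis_free basisX).
Qed.

End Coordinates.

(** * Rank one operators and the alternating term *)

Lemma term_of_comb (Omega : nat -> Type) (K : fieldType) (G : semigroupType)
    (n : nat) (c : 'I_n -> K) :
  exists t : term Omega K G 'I_n,
    forall (deg0 : Omega 0%N -> G) (A : grOmegaAlgType K deg0) (a : 'I_n -> A),
      tev a t = \sum_k c k *: a k.
Proof.
exists (foldr (fun k t => TLin (c k) (TVar k) t) TZero (enum 'I_n)).
move=> deg0 A a; rewrite -big_enum /=.
by elim: (enum _) => [|k r IH] /=; rewrite ?big_nil // big_cons IH.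
Qed.

(** By [ctx_irreducible] and [burnside] every linear operator is the value of a
    context. *)
Lemma rank_one_ctx (Omega : nat -> Type) (K : closedFieldType)
    (G : semigroupType) (deg0 : Omega 0%N -> G) (A : grOmegaAlgType K deg0)
    (n : nat) (X : n.-tuple A) (V : Type) (a : V -> A) (i : 'I_n) (y : A) :
  gr_simple A -> basis_of fullv X -> (forall z, exists t, tev a t = z) ->
  exists c, forall x, cev a c x = coord X i x *: y.
Proof.
move=> simple bX gen.
pose M (m : 'M[K]_n) := exists c : ctx Omega K G V, op_mx X (cev a c) = m.
have : M (\matrix_(k, j) ((k == i)%:R * coord X j y)).
  apply: burnside => [|k _ _ [c <-] [d <-]|_ _ [c <-] [d <-]|u v u0].
  - by exists Hole; apply: op_mx_id.
  - exists (CLin k c d); apply/matrixP => p q.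
    by rewrite !mxE /= linearP.
  - exists (ccomp d c); rewrite -(coord_mx_op bX); apply/matrixP => p q.
    by rewrite !mxE cev_comp.
  pose vec (r : 'rV[K]_n) := \sum_k r 0 k *: X`_k.
  have vec0 : vec u <> 0.
    move=> e; case/negP: u0; apply/eqP/rowP => j.
    by rewrite -(coord_comb bX (u 0)) -/(vec u) e linear0 mxE.
  have [c cE] := ctx_irreducible (vec v) simple gen vec0.
  exists (op_mx X (cev a c)); first by exists c.
  apply/rowP => j; rewrite -(coord_comb bX (v 0) j) -/(vec v) -cE /vec.
  rewrite !linear_sum !mxE; apply: eq_bigr => k _.
  by rewrite !linearZ !mxE.
case=> c cE; exists c => x; rewrite [x in LHS](coord_sum bX) linear_sum /=.
rewrite (bigD1 i) //= big1 ?addr0 => [|k ki].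
  rewrite linearZ /=; congr (_ *: _); apply: (coord_inj bX) => j.
  by have /matrixP /(_ i j) := cE; rewrite !mxE eqxx mul1r.
rewrite linearZ /= (_ : cev a c _ = 0) ?scaler0 //.
apply: (coord_inj bX) => j; rewrite linear0.
by have /matrixP /(_ k j) := cE; rewrite !mxE (negbTE ki) mul0r.
Qed.

Section Chain.
Variables (Omega : nat -> Type) (K : fieldType) (G : semigroupType) (n : nat).
Local Notation term := (term Omega K G 'I_n).
Local Notation ctx := (ctx Omega K G 'I_n).
Variables (m : nat) (w : Omega m) (i0 i1 : 'I_m) (q : 'I_m -> term).
Variables (C : ctx) (cs : 'I_n -> ctx).
Hypothesis i01 : i1 != i0.

(** Nesting turns a product of scalars into a term.  Let the values p_j of the
    [q j] satisfy w(p) <> 0, let [cs i] send x to the i-th coordinate of x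
    times p_i1, and let [C] send w(p) back to p_i0.  Then the chain over r is
    p_i0 times the product, over i in r, of the i-th coordinate of the i-th
    argument. *)
Fixpoint chain (r : seq 'I_n) (xs : 'I_n -> term) : term :=
  match r with
  | [::] => q i0
  | i :: r => plug C (TOp w (fun j => if j == i0 then chain r xs
                       else if j == i1 then plug (cs i) (xs i) else q j))
  end.

Definition alternating_term (xs : 'I_n -> term) : term :=
  foldr (fun (s : 'S_n) t =>
           TLin ((-1) ^+ s) (chain (enum 'I_n) (fun i => xs (s i))) t)
        TZero (enum 'S_n).

Variables (deg0 : Omega 0%N -> G) (B : grOmegaAlgType K deg0) (b : 'I_n -> B).

Fixpoint chain_value (r : seq 'I_n) (y : {ffun 'I_n -> B}) : B :=
  match r with
  | [::] => tev b (q i0)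
  | i :: r => cev b C (oapp w
      (upd (upd [ffun j => tev b (q j)] i1 (cev b (cs i) (y i))) i0 (chain_value r y)))
  end.

Lemma tev_chain r xs : tev b (chain r xs) = chain_value r [ffun i => tev b (xs i)].
Proof.
elim: r => [//|i r IH]; rewrite /= tev_plug /= -IH; congr (cev b C (oapp w _)).
apply/ffunP => j; rewrite !ffunE; case: (j == i0) => //.
by case: (j == i1); rewrite // tev_plug.
Qed.

Lemma chain_value_out r y i x : i \notin r ->
  chain_value r (upd y i x) = chain_value r y.
Proof.
elim: r => [//|j r IH]; rewrite inE negb_or => /andP[ij ir] /=.
by rewrite IH // ffunE eq_sym (negbTE ij).
Qed.

Lemma upd_comm (y : {ffun 'I_m -> B}) (i j : 'I_m) u v : i != j ->
  upd (upd y i u) j v = upd (upd y j v) i u.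
Proof.
move=> ij; apply/ffunP => k; rewrite !ffunE; case: eqP => [->|//].
by rewrite eq_sym (negbTE ij).
Qed.

Lemma chain_value_lin r i y k u v : uniq r -> i \in r ->
  chain_value r (upd y i (k *: u + v)) =
  k *: chain_value r (upd y i u) + chain_value r (upd y i v).
Proof.
elim: r => [//|j r IH] /= /andP[jr ur]; rewrite inE => /predU1P[ij|ir].
  rewrite -ij in jr *; rewrite !(chain_value_out _ _ jr) !ffunE eqxx linearP.
  by rewrite !(upd_comm _ _ _ i01) oapp_multilinear linearP.
have ij : (j == i) = false by apply: contraNF jr => /eqP ->.
by rewrite IH // oapp_multilinear linearP !ffunE ij.
Qed.

Lemma tev_alternating xs :
  multilinear (chain_value (enum 'I_n)) /\
  tev b (alternating_term xs) =
    alternation (chain_value (enum 'I_n)) (fun i => tev b (xs i)).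
Proof.
split=> [i y k u v|]; first by apply: chain_value_lin; rewrite ?enum_uniq ?mem_enum.
rewrite /alternation -big_enum /= /alternating_term.
elim: (enum 'S_n) => [|s r IH] /=; rewrite ?big_nil // big_cons -IH tev_chain.
by congr (_ *: _ + _); congr chain_value; apply/ffunP => i; rewrite !ffunE.
Qed.

End Chain.

(** Take coordinates with respect to the basis X and let the variables be its
    elements: the chain is a product of coordinate functions, so its
    alternation at X is the determinant of the identity matrix times a
    nonzero element. *)
Lemma exists_alternating_term (Omega : nat -> Type) (K : closedFieldType)
    (G : semigroupType) (deg0 : Omega 0%N -> G) (A : grOmegaAlgType K deg0)
    (n : nat) (X : n.-tuple A) :
  gr_simple A -> basis_of fullv X ->
  exists E : ('I_n -> term Omega K G 'I_n) -> term Omega K G 'I_n,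
    (exists a : 'I_n -> A, tev a (E TVar) <> 0) /\
    forall (B : grOmegaAlgType K deg0) (b : 'I_n -> B),
      exists2 T : {ffun 'I_n -> B} -> B, multilinear T &
        forall xs, tev b (E xs) = alternation T (fun i => tev b (xs i)).
Proof.
move=> simple bX; have [[m [w [p [m2 wp]]]] _] := simple.
pose a (i : 'I_n) := X`_i.
have gen z : exists t, tev a t = z.
  have [t tE] := term_of_comb Omega G (fun k => coord X k z).
  by exists t; rewrite tE -(coord_sum bX).
have /choice[q qE] : forall j, exists t, tev a t = p j by move=> j; apply: gen.
pose i0 : 'I_m := Ordinal (ltnW m2); pose i1 : 'I_m := Ordinal m2.
have i01 : i1 != i0 by [].
have [C CE] := ctx_irreducible (p i0) simple gen wp.
have /choice[cs csE] : forall i, exists c, forall x, cev a c x = coord X i x *: p i1.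
  by move=> i; apply: rank_one_ctx.
have value r y : chain_value w i0 i1 q C cs a r y = (\prod_(i <- r) coord X i (y i)) *: p i0.
  elim: r => [|i r IH] /=; first by rewrite big_nil scale1r qE.
  rewrite IH csE -(addr0 (_ *: p i0)) oapp_multilinear.
  rewrite (multilinear0 (@omega_multilinear _ _ _ _ A m w)) addr0.
  rewrite upd_comm // -(addr0 (_ *: p i1)) oapp_multilinear.
  rewrite (multilinear0 (@omega_multilinear _ _ _ _ A m w)) addr0.
  rewrite (_ : upd _ i1 _ = p); last first.
    by apply/ffunP => j; rewrite !ffunE; do 2! case: eqP => [->//|_].
  by rewrite !linearZ /= CE scalerA big_cons mulrC.
exists (alternating_term w i0 i1 q C cs); split; last first.
  move=> B b; exists (chain_value w i0 i1 q C cs b (enum 'I_n)) => [|xs].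
    by case: (tev_alternating w q C cs i01 b TVar).
  by case: (tev_alternating w q C cs i01 b xs).
exists a; have [_ ->] := tev_alternating w q C cs i01 a TVar.
rewrite /alternation; under eq_bigr => s _ do rewrite value scalerA.
rewrite -scaler_suml (_ : \sum_s _ = \det (1%:M : 'M[K]_n)).
  rewrite det1 scale1r => p0; apply: wp.
  have := multilinear0 (@omega_multilinear _ _ _ _ A m w) i0 p.
  by rewrite -p0 upd_id.
apply: eq_bigr => s _; congr (_ * _); rewrite big_enum /=.
apply: eq_bigr => i _; rewrite ffunE /= coord_free ?(basis_free bX) // mxE.
by rewrite eq_sym.
Qed.

(** Fill up a basis with zeros to a spanning family of n vectors. *)
Lemma alternation_dim (K : fieldType) (V : vectType K) (W : lmodType K) (n : nat)
    (T : {ffun 'I_n -> V} -> W) (x : 'I_n -> V) :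
  multilinear T -> (\dim {:V} < n)%N -> alternation T x = 0.
Proof.
move=> T_lin lt; pose e (i : 'I_n) := (vbasis {:V})`_i.
have /choice[c cE] i : exists c : 'I_n -> K, x i = \sum_k c k *: e k.
  pose F (k : nat) := if insub k is Some j then coord (vbasis {:V}) j (x i) else 0.
  exists (fun k => F k); transitivity (\sum_(j < \dim {:V}) F j *: (vbasis {:V})`_j).
    rewrite {1}(coord_vbasis (memvf (x i))); apply: eq_bigr => j _.
    by rewrite /F valK.
  rewrite (big_ord_widen _ (fun k => F k *: (vbasis {:V})`_k) (ltnW lt)) big_mkcond.
  apply: eq_bigr => k _; case: ifPn => // ge.
  by rewrite /F insubN // scale0r.
rewrite (alternation_det (X := \matrix_(i, k) c i k) (e := e) T_lin); last first.
  by move=> i; rewrite cE; apply: eq_bigr => k _; rewrite mxE.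
rewrite /alternation big1 ?scaler0 // => s _.
pose k := Ordinal lt; pose i := (s^-1)%g k.
rewrite (_ : finfun _ = upd [ffun j => e (s j)] i 0).
  by rewrite (multilinear0 T_lin) scaler0.
apply/ffunP => j; rewrite !ffunE; case: eqP => // ->.
by rewrite permKV /e nth_default // size_tuple.
Qed.

(** * Determinants of contexts *)

Inductive det_poly (Omega : nat -> Type) (K : fieldType) (G : semigroupType)
    (V : Type) : Type :=
| DConst of K
| DDet of ctx Omega K G V
| DAdd of det_poly Omega K G V & det_poly Omega K G V
| DMul of det_poly Omega K G V & det_poly Omega K G V.

Section DetPoly.
Variables (Omega : nat -> Type) (K : fieldType) (G : semigroupType) (n : nat).
Local Notation term := (term Omega K G 'I_n).
Local Notation det_poly := (det_poly Omega K G 'I_n).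

(** If E is a determinant in its arguments, up to a constant vector, putting
    c(x) for each argument x multiplies E by the determinant of c.  The result
    is again of this kind, so such steps can be iterated. *)
Fixpoint scaled_term (s : det_poly) (E : ('I_n -> term) -> term) :
    ('I_n -> term) -> term :=
  match s with
  | DConst k => fun xs => TLin k (E xs) TZero
  | DDet c => fun xs => E (fun i => plug c (xs i))
  | DAdd s t => fun xs => TLin 1 (scaled_term s E xs) (scaled_term t E xs)
  | DMul s t => scaled_term s (scaled_term t E)
  end.

Variables (deg0 : Omega 0%N -> G) (A : grOmegaAlgType K deg0) (X : n.-tuple A).

Fixpoint dval (a : 'I_n -> A) (s : det_poly) : K :=
  match s with
  | DConst k => k
  | DDet c => \det (op_mx X (cev a c))
  | DAdd s t => dval a s + dval a t
  | DMul s t => dval a s * dval a t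
  end.

Hypothesis bX : basis_of fullv X.

Lemma tev_scaled_term (a : 'I_n -> A) (E : ('I_n -> term) -> term) (y : A) s xs :
  (forall xs, tev a (E xs) = \det (coord_mx X (fun i => tev a (xs i))) *: y) ->
  tev a (scaled_term s E xs) =
    (dval a s * \det (coord_mx X (fun i => tev a (xs i)))) *: y.
Proof.
elim: s E y xs => [k|c|s IHs t IHt|s IHs t IHt] E y xs EE /=.
- by rewrite EE addr0 scalerA.
- rewrite EE (_ : coord_mx _ _ = coord_mx X (fun i => cev a c (tev a (xs i)))).
    by rewrite (coord_mx_op bX) det_mulmx mulrC.
  by apply/matrixP => i j; rewrite !mxE tev_plug.
- by rewrite (IHs _ _ _ EE) (IHt _ _ _ EE) scale1r -scalerDl mulrDl.
- rewrite (IHs _ (dval a t *: y)) ?scalerA; first by rewrite mulrAC.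
  by move=> ys; rewrite (IHt _ _ _ EE) scalerA mulrC.
Qed.

End DetPoly.

(** * Polynomial dependence on the coordinates *)

Section Polynomial.
Variables (K : closedFieldType) (N : nat).
Implicit Types f g : ('I_N -> K) -> K.

Definition polynomial f := exists p : {mpoly K[N]}, forall v, p.@[v] = f v.

Lemma polynomial_const c : polynomial (fun=> c).
Proof. by exists c%:MP => v; rewrite mevalC. Qed.

Lemma polynomial_add f g : polynomial f -> polynomial g ->
  polynomial (fun v => f v + g v).
Proof. by move=> [p pE] [q qE]; exists (p + q) => v; rewrite mevalD pE qE. Qed.

Lemma polynomial_mul f g : polynomial f -> polynomial g ->
  polynomial (fun v => f v * g v).
Proof. by move=> [p pE] [q qE]; exists (p * q) => v; rewrite mevalM pE qE. Qed.

Lemma polynomial_sum (I : finType) (f : I -> ('I_N -> K) -> K) :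
  (forall i, polynomial (f i)) -> polynomial (fun v => \sum_i f i v).
Proof.
move=> /choice[p pE]; exists (\sum_i p i) => v.
by rewrite (raddf_sum (meval v)) /=; apply: eq_bigr => i _.
Qed.

Lemma polynomial_prod (I : finType) (f : I -> ('I_N -> K) -> K) :
  (forall i, polynomial (f i)) -> polynomial (fun v => \prod_i f i v).
Proof.
move=> /choice[p pE]; exists (\prod_i p i) => v.
by rewrite (rmorph_prod (meval v)) /=; apply: eq_bigr => i _.
Qed.

Lemma polynomial_det n (M : ('I_N -> K) -> 'M[K]_n) :
  (forall i j, polynomial (fun v => M v i j)) -> polynomial (fun v => \det (M v)).
Proof.
move=> MP; apply: polynomial_sum => s; apply: polynomial_mul.
  exact: polynomial_const.
exact: polynomial_prod.
Qed.

Lemma mpoly_eq0_values (p : {mpoly K[N]}) : (forall v, p.@[v] = 0) -> p = 0.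
Proof.
move=> p0; apply/eqP/negPn/negP => /nonzero_value[v].
by rewrite p0 eqxx.
Qed.

Lemma polynomial_domain f g : polynomial f -> polynomial g ->
  (forall v, f v * g v = 0) -> (exists v, g v != 0) -> forall v, f v = 0.
Proof.
move=> [p pE] [q qE] fg [u gu] v.
have /eqP : p * q = 0 by apply: mpoly_eq0_values => t; rewrite mevalM pE qE fg.
rewrite mulf_eq0 => /orP[] /eqP e; first by rewrite -pE e meval0.
by move: gu; rewrite -qE e meval0 eqxx.
Qed.

End Polynomial.

Section Points.
Variables (Omega : nat -> Type) (K : closedFieldType) (G : semigroupType).
Variables (deg0 : Omega 0%N -> G) (A : grOmegaAlgType K deg0) (n : nat).
Variables (X : n.-tuple A) (bX : basis_of fullv X).
Local Notation point := ('I_(n * n) -> K).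
Local Notation det_poly := (det_poly Omega K G 'I_n).

(** The coordinates of n elements of an n-dimensional algebra are indexed as the
    entries of a square matrix, flattened to match polynomials in n * n
    variables. *)
Definition assign (v : point) (i : 'I_n) : A :=
  \sum_k v (mxvec_index i k) *: X`_k.

Lemma assign_surj (a : 'I_n -> A) : exists v, assign v = a.
Proof.
exists (mxvec (coord_mx X a) 0); apply/funext => i; rewrite [RHS](coord_sum bX).
by apply: eq_bigr => k _; rewrite mxvecE mxE.
Qed.

Definition vpolynomial (u : point -> A) :=
  forall j, polynomial (fun v => coord X j (u v)).

Lemma vpolynomial_const x : vpolynomial (fun=> x).
Proof. by move=> j; apply: polynomial_const. Qed.

Lemma vpolynomial_lin k u u' : vpolynomial u -> vpolynomial u' ->
  vpolynomial (fun v => k *: u v + u' v).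
Proof.
move=> up up' j; under eq_fun do rewrite linearP /=.
by apply: polynomial_add => //; apply: polynomial_mul => //; apply: polynomial_const.
Qed.

Lemma vpolynomial_linear (h : {linear A -> A}) u : vpolynomial u ->
  vpolynomial (fun v => h (u v)).
Proof.
move=> up j; under eq_fun => v do rewrite (coord_sum bX (u v)) !linear_sum /=.
apply: polynomial_sum => k; under eq_fun do rewrite !linearZ /=.
by apply: polynomial_mul => //; apply: polynomial_const.
Qed.

Lemma vpolynomial_op m (w : Omega m) (u : 'I_m -> point -> A) :
  (forall i, vpolynomial (u i)) -> vpolynomial (fun v => oapp w [ffun i => u i v]).
Proof.
move=> up j.
have E v : oapp w [ffun i => u i v] = \sum_(f : {ffun 'I_m -> 'I_n})
    (\prod_i coord X (f i) (u i v)) *: oapp w [ffun i => X`_(f i)].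
  rewrite -(multilinear_expand (@omega_multilinear _ _ _ _ A m w) (fun k : 'I_n => X`_k)
    (fun i k => coord X k (u i v))).
  by congr oapp; apply/ffunP => i; rewrite !ffunE -(coord_sum bX).
under eq_fun do rewrite E linear_sum /=.
apply: polynomial_sum => f; under eq_fun do rewrite linearZ /=.
apply: polynomial_mul; last exact: polynomial_const.
by apply: polynomial_prod => i; apply: up.
Qed.

Lemma vpolynomial_tev t : vpolynomial (fun v => tev (assign v) t).
Proof.
elim: t => [i|m w t IH|g t IH||k t IHt u IHu] /=.
- move=> j; under eq_fun do rewrite (coord_comb bX).
  by exists 'X_(mxvec_index i j) => v; rewrite mevalXU.
- exact: vpolynomial_op.
- exact: vpolynomial_linear.
- exact: vpolynomial_const.
- exact: vpolynomial_lin.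
Qed.

Lemma vpolynomial_cev c x : vpolynomial (fun v => cev (assign v) c x).
Proof.
elim: c => [|m w i t c IH|g c IH|k c IHc d IHd] /=.
- exact: vpolynomial_const.
- have E v : upd [ffun j => tev (assign v) (t j)] i (cev (assign v) c x) =
      [ffun j => if j == i then cev (assign v) c x else tev (assign v) (t j)].
    by apply/ffunP => j; rewrite !ffunE.
  under eq_fun do rewrite E.
  by apply: vpolynomial_op => j; case: (j == i) => //; apply: vpolynomial_tev.
- exact: vpolynomial_linear.
- exact: vpolynomial_lin.
Qed.

Lemma polynomial_dval (s : det_poly) : polynomial (fun v => dval X (assign v) s).
Proof.
elim: s => [k|c|s IHs t IHt|s IHs t IHt] /=.
- exact: polynomial_const.
- apply: polynomial_det => i j; under eq_fun do rewrite mxE.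
  exact: vpolynomial_cev.
- exact: polynomial_add.
- exact: polynomial_mul.
Qed.

Lemma spanning_gen v : \det (coord_mx X (assign v)) != 0 ->
  forall z, exists t : term Omega K G 'I_n, tev (assign v) t = z.
Proof.
rewrite -unitfE -[_ \is a _]/(coord_mx X (assign v) \in unitmx) => inv z.
pose M := coord_mx X (assign v).
pose c := (\row_k coord X k z) *m invmx M.
have [t tE] := term_of_comb Omega G (fun k => c 0 k); exists t.
rewrite tE; apply: (coord_inj bX) => j; rewrite linear_sum /=.
have /matrixP /(_ 0 j) : c *m M = \row_k coord X k z by rewrite mulmxKV.
rewrite !mxE => <-; apply: eq_bigr => k _; by rewrite linearZ /= [M k j]mxE.
Qed.

(** The scaled term is the product of the polynomial functions s and E, and
    polynomial functions over an infinite field form a domain. *)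
Lemma dval_eq0_term (E : ('I_n -> term Omega K G 'I_n) -> term Omega K G 'I_n) s :
  (forall a : 'I_n -> A, exists2 T : {ffun 'I_n -> A} -> A, multilinear T &
     forall xs, tev a (E xs) = alternation T (fun i => tev a (xs i))) ->
  (exists a : 'I_n -> A, tev a (E TVar) <> 0) ->
  (forall a : 'I_n -> A, dval X a s = 0) <->
  (forall a : 'I_n -> A, tev a (scaled_term s E TVar) = 0).
Proof.
move=> alt [a0 Ea0].
have scaled a : tev a (scaled_term s E TVar) = dval X a s *: tev a (E TVar).
  have [T T_lin TE] := alt a.
  have EE xs : tev a (E xs) = \det (coord_mx X (fun i => tev a (xs i))) *:
      alternation T (fun k => X`_k).
    rewrite TE (alternation_det (X := coord_mx X (fun i => tev a (xs i)))
                                (e := fun k => X`_k) T_lin) // => i.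
    by rewrite {1}[tev a _](coord_sum bX); apply: eq_bigr => k _; rewrite mxE.
  by rewrite (tev_scaled_term bX _ _ EE) EE scalerA.
split=> [d0 a|e0 a]; first by rewrite scaled d0 scale0r.
have [v <-] := assign_surj a; have [v0 v0E] := assign_surj a0.
have [j cj] : exists j, coord X j (tev a0 (E TVar)) != 0.
  apply: contrapT => ne; apply: Ea0; apply: (coord_inj bX) => j; rewrite linear0.
  by apply: contra_notP ne => /eqP; exists j.
apply: (polynomial_domain (polynomial_dval s)
  (vpolynomial_tev (E TVar) j)) => [u|]; last by exists v0; rewrite v0E.
by rewrite -linearZ -scaled e0 linear0.
Qed.

End Points.

(** * Points with equal determinants *)

Section Comparison.
Variables (Omega : nat -> Type) (K : closedFieldType) (G : semigroupType).
Variables (deg0 : Omega 0%N -> G) (n : nat).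
Local Notation term := (term Omega K G 'I_n).
Local Notation det_poly := (det_poly Omega K G 'I_n).

(** Suppose t vanishes at a but not at b.  Plugging t into an operation w that
    is nonzero on B gives a context W that is zero at a and satisfies W(p_1) = w(p)
    at b, with w(p) nonzero.  Choose C with C(w(p)) = - p_1 at b: then 1 + W C
    is the identity at a but kills w(p) at b, and the determinants differ. *)
Lemma kernel_transfer (A B : grOmegaAlgType K deg0) (X : n.-tuple A)
    (Y : n.-tuple B) (a : 'I_n -> A) (b : 'I_n -> B) (t : term) :
  gr_simple B -> basis_of fullv X -> basis_of fullv Y ->
  (forall z, exists u : term, tev b u = z) ->
  (forall s : det_poly, dval X a s = dval Y b s) ->
  tev a t = 0 -> tev b t = 0.
Proof.
move=> simple bX bY gen same at0; apply: contrapT => bt0.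
have [[m [w [p [m2 wp]]]] _] := simple.
pose i0 : 'I_m := Ordinal (ltnW m2); pose i1 : 'I_m := Ordinal m2.
have i01 : i1 != i0 by [].
have /choice[q qE] : forall j, exists u, tev b u = p j by move=> j; apply: gen.
have [c0 c0E] := ctx_irreducible (p i0) simple gen bt0.
pose W := COp w i1 (fun j => if j == i0 then plug c0 t else q j) Hole.
have [C CE] := ctx_irreducible (- p i1) simple gen wp.
have Wb : cev b W (p i1) = oapp w p.
  congr oapp; apply/ffunP => j; rewrite !ffunE; case: eqP => [->//|_].
  by case: eqP => [->|//]; rewrite tev_plug.
have Wa x : cev a W x = 0.
  rewrite /= (_ : upd _ _ _ = upd (upd [ffun j => tev a (q j)] i1 x) i0 0).
    exact: (multilinear0 (@omega_multilinear _ _ _ _ A m w)).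
  apply/ffunP => j; rewrite !ffunE.
  case: (eqVneq j i1) => [->|_]; first by rewrite (negbTE i01).
  by case: eqP => // _; rewrite tev_plug at0 linear0.
clearbody W; have := same (DDet (CLin 1 Hole (ccomp W C))).
rewrite /= (_ : op_mx X _ = 1%:M); last first.
  rewrite -(op_mx_id bX); apply/matrixP => i j.
  by rewrite !mxE /= cev_comp Wa scale1r addr0.
rewrite det1 => /esym/eqP; apply/negP; set D := op_mx Y _.
have : (\row_k coord Y k (oapp w p)) *m D = 0.
  apply/rowP => j; rewrite [RHS]mxE.
  transitivity (coord Y j (cev b (CLin 1 Hole (ccomp W C)) (oapp w p))).
    rewrite [X in cev _ _ X](coord_sum bY) !linear_sum mxE.
    by apply: eq_bigr => k _; rewrite !linearZ !mxE.
  by rewrite /= cev_comp CE linearN /= Wb scale1r subrr linear0.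
move=> rD; apply/negP => /eqP detD.
have Du : D \in unitmx by rewrite unitmxE detD unitr1.
apply: wp; apply: (coord_inj bY) => j; rewrite linear0.
have /matrixP /(_ 0 j) : \row_k coord Y k (oapp w p) = 0.
  by rewrite -[LHS](mulmxK Du) rD mul0mx.
by rewrite !mxE.
Qed.

Lemma isomorphic_of_kernel (A B : grOmegaAlgType K deg0)
    (a : 'I_n -> A) (b : 'I_n -> B) :
  (forall z, exists u : term, tev a u = z) ->
  (forall z, exists u : term, tev b u = z) ->
  (forall t : term, tev a t = 0 <-> tev b t = 0) ->
  gr_isomorphic A B.
Proof.
move=> /choice[u uE] /choice[u' u'E] ker.
have ext t t' : tev a t = tev a t' <-> tev b t = tev b t'.
  have := ker (TLin (-1) t' t); rewrite /= !scaleN1r ![- _ + _]addrC.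
  by case=> h1 h2; split=> e; apply/eqP; rewrite -subr_eq0;
    apply/eqP; [apply: h1 | apply: h2]; rewrite e subrr.
pose psi z := tev b (u z).
have psiE t : psi (tev a t) = tev b t by apply/ext; rewrite uE.
have psi_lin : linear psi.
  move=> k x y; rewrite -[RHS]/(tev b (TLin k (u x) (u y))) -psiE.
  by rewrite /= !uE.
pose psiL : {linear A -> B} := HB.pack psi (@GRing.isLinear.Build K A B _ psi psi_lin).
exists psiL; split=> /= [m w z|g z zg|].
- have -> : oapp w z = tev a (TOp w (fun i => u (z i))).
    by rewrite /=; congr oapp; apply/ffunP => i; rewrite ffunE uE.
  exact: psiE.
- have -> : z = tev a (TProj g (u z)) by rewrite /= uE (gproj_hom _ zg) eqxx.
  by rewrite psiE gproj_mem.
- exists (fun y => tev a (u' y)) => [z|y]; last by rewrite psiE u'E.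
  by rewrite -[RHS](uE z); apply/ext; rewrite u'E.
Qed.

Variables (A B : grOmegaAlgType K deg0) (X : n.-tuple A) (Y : n.-tuple B).
Hypotheses (bX : basis_of fullv X) (bY : basis_of fullv Y).
Local Notation P := {mpoly K[(n * n)%N]}.

(** The ring of polynomials in determinants appears as a ring of pairs of
    functions, one on each algebra; if the same expressions vanish on both
    algebras, each projection of this ring is injective. *)
Definition common_values (p : P * P) : bool :=
  `[< exists s : det_poly, (forall v, p.1.@[v] = dval X (assign X v) s) /\
                           (forall v, p.2.@[v] = dval Y (assign Y v) s) >].

Lemma common_values_subring : subring_closed common_values.
Proof.
split.
- by apply/asboolP; exists (DConst _ _ _ 1); split=> v; rewrite meval1.
- move=> p q /asboolP[s [s1 s2]] /asboolP[t [t1 t2]]; apply/asboolP.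
  exists (DAdd s (DMul (DConst _ _ _ (-1)) t)).
  by split=> v; rewrite mevalB /= mulN1r ?s1 ?s2 ?t1 ?t2.
- move=> p q /asboolP[s [s1 s2]] /asboolP[t [t1 t2]]; apply/asboolP.
  by exists (DMul s t); split=> v; rewrite mevalM /= ?s1 ?s2 ?t1 ?t2.
Qed.

HB.instance Definition _ := GRing.isSubringClosed.Build _ common_values common_values_subring.

Record common_ring := CommonRing { common_val :> P * P; _ : common_val \in common_values }.
HB.instance Definition _ := [isSub for common_val].
HB.instance Definition _ := [Choice of common_ring by <:].
HB.instance Definition _ := [SubChoice_isSubComNzRing of common_ring by <:].

(** The point a is chosen off the zeros of the element r given by
    [extension_point], and with independent entries; evaluation at a of the
    first projection is a homomorphism on the ring of common values, and
    extends to evaluation of the second projection at some b. *)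
Lemma exists_common_points :
  (forall s : det_poly, (forall a, dval X a s = 0) <-> (forall b, dval Y b s = 0)) ->
  exists (a : 'I_n -> A) (b : 'I_n -> B),
  [/\ forall s : det_poly, dval X a s = dval Y b s,
      forall z, exists u : term, tev a u = z
    & forall z, exists u : term, tev b u = z].
Proof.
move=> same.
pose D : P := \det (\matrix_(i, j) 'X_(mxvec_index i j)).
have DE v : D.@[v] = \det (\matrix_(i, j) v (mxvec_index i j)).
  rewrite /D -[LHS](det_map_mx (meval v)); congr (\det _).
  by apply/matrixP => i j; rewrite !mxE; apply: mevalXU.
have D_X v : \det (coord_mx X (assign X v)) = D.@[v].
  rewrite DE; congr (\det _); apply/matrixP => i j.
  by rewrite !mxE (coord_comb bX).
have D_Y v : \det (coord_mx Y (assign Y v)) = D.@[v].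
  rewrite DE; congr (\det _); apply/matrixP => i j.
  by rewrite !mxE (coord_comb bY).
have D0 : D != 0.
  apply: contraNneq (oner_neq0 K) => e; apply/eqP.
  transitivity D.@[mxvec (1%:M : 'M[K]_n) 0]; last by rewrite e meval0.
  rewrite DE -[LHS](det1 K n); congr (\det _).
  by apply/matrixP => i j; rewrite [RHS]mxE mxvecE.
pose alpha : {rmorphism common_ring -> P} := fst \o (val : common_ring -> P * P).
pose beta : {rmorphism common_ring -> P} := snd \o (val : common_ring -> P * P).
have ker r : alpha r = 0 <-> beta r = 0.
  case: r => [[p q] /= r]; rewrite /alpha /beta /=.
  have /asboolP[s [/= s1 s2]] := r; split=> e; apply: mpoly_eq0_values => v.
    rewrite s2; apply: (same s).1 => a; have [u <-] := assign_surj bX a.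
    by rewrite -s1 e meval0.
  rewrite s1; apply: (same s).2 => b; have [u <-] := assign_surj bY b.
  by rewrite -s2 e meval0.
have constP c : (c%:MP, c%:MP) \in common_values.
  by apply/asboolP; exists (DConst _ _ _ c); split=> v; rewrite mevalC.
have [|r [br ext]] := @extension_point K (n * n)%N common_ring beta
  (fun c => CommonRing (constP c)) D _ D0; first by [].
have : alpha r * D != 0.
  by rewrite mulf_neq0 //; apply: contraNneq br => /ker ->.
case/nonzero_value => v; rewrite mevalM mulf_eq0 negb_or => /andP[arv Dv].
pose phi : {rmorphism common_ring -> K} := meval v \o alpha.
have [c|r' /ker e|//|u [uE Du]] := ext phi.
- by rewrite /phi /= mevalC.
- by rewrite /phi /= -[meval v _]/(meval v (alpha r')) e meval0.
exists (assign X v), (assign Y u); split.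
- move=> s; have [p pE] := polynomial_dval bX s; have [q qE] := polynomial_dval bY s.
  have pq : (p, q) \in common_values by apply/asboolP; exists s.
  by rewrite -pE -qE; apply: (uE (CommonRing pq)).
- by apply: (spanning_gen bX); rewrite D_X.
- by apply: (spanning_gen bY); rewrite D_Y.
Qed.

End Comparison.

(** The alternating term of A would be an identity of a smaller B. *)
Lemma dim_le_of_identities (Omega : nat -> Type) (K : closedFieldType)
    (G : semigroupType) (deg0 : Omega 0%N -> G) (A B : grOmegaAlgType K deg0) :
  gr_simple A ->
  (forall t : term Omega K G 'I_(\dim {:A}),
     (forall b : _ -> B, tev b t = 0) -> forall a : _ -> A, tev a t = 0) ->
  (\dim {:A} <= \dim {:B})%N.
Proof.
move=> simple same; rewrite leqNgt; apply/negP => lt.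
have [E [[a Ea] alt]] := exists_alternating_term simple (vbasisP {:A}).
apply: Ea; apply: same => b; have [T T_lin ->] := alt B b.
exact: alternation_dim.
Qed.

Local Close Scope ring_scope.

Theorem corollary3p4 (K : closedFieldType) (Omega : nat -> Type)
    (hOmega : exists m : nat, (2 <= m)%N /\ inhabited (Omega m))
    (G : semigroupType) (deg0 : Omega 0 -> G)
    (X : Type) (hX : exists e : X -> nat, bijective e)
    (A B : grOmegaAlgType K deg0)
    (hA : gr_simple A) (hB : gr_simple B) :
  gr_isomorphic A B <->
  (forall f : free_omega Omega K (X * G),
     gr_identity A f <-> gr_identity B f).
Proof.
split=> [iso f|same]; first exact: isomorphic_same_identities.
have [e [e' eK e'K]] := hX.
have terms n (t : term Omega K G 'I_n) :
    (forall a : 'I_n -> A, tev a t = 0%R) <-> (forall b : 'I_n -> B, tev b t = 0%R).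
  apply: (@same_term_identities _ _ _ _ X _ (fun i => e' (val i))) => //.
  by apply: inj_comp (can_inj e'K) val_inj.
have dimE : \dim {:B} = \dim {:A}.
  apply/eqP; rewrite eqn_leq; apply/andP; split.
    by apply: dim_le_of_identities => // t /terms.
  by apply: dim_le_of_identities => // t /terms.
pose n := \dim {:A}; pose U : n.-tuple A := vbasis {:A}.
pose W : n.-tuple B := tcast dimE (vbasis {:B}).
have bU : basis_of fullv U by apply: vbasisP.
have bW : basis_of fullv W by rewrite val_tcast; apply: vbasisP.
have [E [[a Ea] alt]] := exists_alternating_term hA bU.
have Eb : exists b : 'I_n -> B, tev b (E TVar) <> 0%R.
  apply: contrapT => ne; apply: Ea; apply: (terms _ _).2 => b.
  by apply: contra_notP ne; exists b.
have dets (s : det_poly Omega K G 'I_n) :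
    (forall a, dval U a s = 0%R) <-> (forall b, dval W b s = 0%R).
  rewrite (dval_eq0_term bU s (alt A)); last by exists a.
  by rewrite (dval_eq0_term bW s (alt B) Eb); apply: terms.
have [a' [b' [eq_ab gen_a gen_b]]] := exists_common_points bU bW dets.
apply: (isomorphic_of_kernel gen_a gen_b) => t; split.
  exact: (kernel_transfer hB bU bW gen_b eq_ab).
by apply: (kernel_transfer hA bW bU gen_a) => s.
Qed.
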